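(* Let $M$ be a compact connected $C^\infty$-manifold with fixed volume form $\lambda$, $\int_M d\lambda=1$, and let $d$ be the Riemannian distance of the Fisher metric $G$ on $\mathcal{P}^+(M)$. Then for $\mu,\mu_1\in\mathcal{P}^+(M)$, $$d(\mu,\mu_1)=\ell(\mu,\mu_1).$$ Moreover, if $\mu\neq\mu_1$, a shortest path joining $\mu$ and $\mu_1$ is the geodesic segment of the Levi-Civita connection of $G$ given, with $\ell=\ell(\mu,\mu_1)$, by $$\mu(t)=\left(\cos\frac t2+\sin\frac t2\,\frac{d\tau}{d\mu}\right)^2\mu,\quad t\in[0,\ell],\qquad \tau=\frac{1}{\tan(\ell/2)}\bigl(\sigma(\mu,\mu_1)-\mu\bigr),$$ which is the unique geodesic segment with $\mu(0)=\mu$, $\mu(\ell)=\mu_1$, $|\dot\mu(0)|_\mu=1$ and $\mu([0,\ell])\subset\mathcal{P}^+(M)$.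
   Context: $\mathcal{P}^+(M)$ is the set of probability measures $\mu=f\lambda$ on the Borel sets of $M$ with $f\in C^0(M)$ everywhere positive. The tangent space at $\mu$ is $T_\mu\mathcal{P}^+(M)=\{h\lambda : h\in C^0(M),\ \int_M h\,d\lambda=0\}$. The Fisher metric is $G_\mu(\tau,\tau_1)=\int_M\frac{d\tau}{d\mu}\frac{d\tau_1}{d\mu}\,d\mu$, with norm $|\tau|_\mu=\sqrt{G_\mu(\tau,\tau)}$. A curve in $\mathcal{P}^+(M)$ is $c(t)=f(\cdot,t)\lambda$ with $f(x,t)$ of class $C^2$ in $t$ for each $x$, and its velocity is $\dot c(t)=\frac{\partial f}{\partial t}(\cdot,t)\lambda\in T_{c(t)}\mathcal{P}^+(M)$. The length of a curve is the integral of $|\dot c(t)|_{c(t)}$; the Riemannian distance $d(\mu,\mu_1)$ is the infimum of lengths of (piecewise) such curves in $\mathcal{P}^+(M)$ joining $\mu$ and $\mu_1$, and a shortest path is one realizing this infimum. The Levi-Civita connection of $G$ on constant vector fields $\tau,\tau_1$ is $(\nabla_\tau\tau_1)_\mu=-\frac12\left(\frac{d\tau}{d\mu}\frac{d\tau_1}{d\mu}-G_\mu(\tau,\tau_1)\right)\mu$. The function $\ell:\mathcal{P}^+(M)\times\mathcal{P}^+(M)\to[0,\pi)$ is defined by $\cos\frac{\ell(\mu,\mu_1)}2=\int_M\sqrt{\frac{d\mu_1}{d\mu}}\,d\mu$, and the normalized geometric mean is $\sigma(\mu,\mu_1)=\left(\cos\frac{\ell(\mu,\mu_1)}2\right)^{-1}\sqrt{\frac{d\mu_1}{d\mu}}\,\mu\in\mathcal{P}^+(M)$.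 *)

(* Defs.v *)
From HB Require Import structures.
From mathcomp Require Import all_boot all_order all_algebra.
From mathcomp Require Import all_classical all_reals all_analysis.

Set Implicit Arguments.
Unset Strict Implicit.
Unset Printing Implicit Defensive.

Import Order.TTheory GRing.Theory Num.Theory.
Import numFieldNormedType.Exports.

Local Open Scope classical_set_scope.
Local Open Scope ring_scope.

Section smooth_functions.
Context {R : realType} {n : nat}.

Fixpoint Ck_on (k : nat) (U : set 'rV[R]_n) (f : 'rV[R]_n -> R) : Prop :=
  (forall x, U x -> {for x, continuous f}) /\
  match k with
  | 0%N => True
  | k'.+1 => forall i : 'I_n,
      (forall x, U x -> derivable f x (delta_mx 0 i)) /\
      Ck_on k' U (fun x => 'D_(delta_mx 0 i) f x)
  end.

Definition smooth_on (U : set 'rV[R]_n) (f : 'rV[R]_n -> R) : Prop :=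
  forall k, Ck_on k U f.

End smooth_functions.

(* Tonelli: for a nonnegative Borel function [g] on R^n this iterated integral
   is the integral of [g] against the n-dimensional Lebesgue measure.  On the
   one-point space R^0 it is evaluation. *)
Fixpoint lebesgue_iint {R : realType} (n : nat) :
    ('rV[R]_n -> \bar R) -> \bar R :=
  match n with
  | 0%N => fun g => g 0
  | n'.+1 => fun g =>
      (\int[@lebesgue_measure R]_t
         lebesgue_iint (fun v : 'rV[R]_n' => g (row_mx (const_mx t : 'rV[R]_1) v)))%E
  end.

Section manifolds.
Context {R : realType} {n : nat} {M : ptopologicalType}.

(* [chart_fun] and [chart_inv] are total functions that are only meaningful on
   [chart_dom] and [chart_cod], between which they are inverse
   homeomorphisms. *)
Record chart := Chart {
  chart_dom : set M ;
  chart_cod : set 'rV[R]_n ;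
  chart_fun : M -> 'rV[R]_n ;
  chart_inv : 'rV[R]_n -> M ;
  chart_dom_open : open chart_dom ;
  chart_cod_open : open chart_cod ;
  chart_funP : forall x, chart_dom x ->
    chart_cod (chart_fun x) /\ chart_inv (chart_fun x) = x ;
  chart_invP : forall y, chart_cod y ->
    chart_dom (chart_inv y) /\ chart_fun (chart_inv y) = y ;
  chart_fun_continuous : forall x, chart_dom x ->
    {for x, continuous chart_fun} ;
  chart_inv_continuous : forall y, chart_cod y ->
    {for y, continuous chart_inv}
}.

Definition transition (c c' : chart) : 'rV[R]_n -> 'rV[R]_n :=
  chart_fun c' \o chart_inv c.

Definition transition_dom (c c' : chart) : set 'rV[R]_n :=
  chart_cod c `&` chart_inv c @^-1` chart_dom c'.

End manifolds.
Arguments chart : clear implicits.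

Record smooth_manifold (R : realType) (n : nat) (M : ptopologicalType) :=
  SmoothManifold {
  atlas : set (chart R n M) ;
  manifold_hausdorff : hausdorff_space M ;
  manifold_second_countable : @second_countable M ;
  atlas_cover : forall x, exists2 c, atlas c & chart_dom c x ;
  atlas_smooth : forall c c', atlas c -> atlas c' -> forall i : 'I_n,
    smooth_on (transition_dom c c') (fun y => transition c c' y 0 i)
}.

(* A nowhere vanishing smooth n-form.  In the chart [c] it reads
   [vol_coef c y dy_1 /\ ... /\ dy_n]; [vol_change] is the transformation rule
   of n-forms. *)
Record volume_form (R : realType) (n : nat) (M : ptopologicalType)
    (X : smooth_manifold R n M) := VolumeForm {
  vol_coef : chart R n M -> 'rV[R]_n -> R ;
  vol_smooth : forall c, atlas X c -> smooth_on (chart_cod c) (vol_coef c) ;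
  vol_neq0 : forall c, atlas X c -> forall y, chart_cod c y ->
    vol_coef c y != 0 ;
  vol_change : forall c c', atlas X c -> atlas X c' ->
    forall y, transition_dom c c' y ->
    vol_coef c y =
      vol_coef c' (transition c c' y) * \det ('J (transition c c') y)
}.

Definition borel (M : ptopologicalType) := g_sigma_algebraType (@open M).

(* [lam] is the Borel measure defined by the volume form [w], [M] being
   oriented by [w]. *)
Definition is_volume_measure (R : realType) (n : nat) (M : ptopologicalType)
    (X : smooth_manifold R n M) (w : volume_form X)
    (lam : probability (borel M) R) : Prop :=
  forall c, atlas X c ->
  forall A : set (borel M), measurable A -> A `<=` chart_dom c ->
    lam A = lebesgue_iint (fun y =>
      if y \in chart_cod c `&` chart_inv c @^-1` A
      then (`|vol_coef w c y|)%:E else 0%E).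

Section statistical_manifold.
Context {R : realType} {M : ptopologicalType}.

(* Signed measures are handled through their values on Borel sets: only these
   values are ever used, and two of them are identified by [=m]. *)
Definition eqm (m1 m2 : set (borel M) -> \bar R) : Prop :=
  forall A : set (borel M), measurable A -> m1 A = m2 A.

Local Notation "m1 =m m2" := (eqm m1 m2) (at level 70).

(* the signed measure [h mu] *)
Definition wmeas (mu : probability (borel M) R) (h : M -> R) :
    set (borel M) -> \bar R :=
  fun A => (\int[mu]_(x in A) (h x)%:E)%E.

Definition Pplus (lam : probability (borel M) R)
    (m : set (borel M) -> \bar R) : Prop :=
  exists f : M -> R, [/\ continuous f, (forall x, 0 < f x),
    wmeas lam f setT = 1%E & m =m wmeas lam f].

(* The tangent space is the same at all points of [Pplus lam]. *)
Definition tangent (lam : probability (borel M) R)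
    (tau : set (borel M) -> \bar R) : Prop :=
  exists h : M -> R, [/\ continuous h,
    wmeas lam h setT = 0%E & tau =m wmeas lam h].

(* The continuous version of the Radon-Nikodym derivative d tau / d mu, as a
   real-valued function; the library's ['d tau '/d mu] is only fixed up to
   [mu]-null sets, whereas the values at every point matter here. *)
Definition RNd (tau : set (borel M) -> \bar R)
    (mu : probability (borel M) R) : M -> R :=
  xget (cst 0) [set h : M -> R | continuous h /\ tau =m wmeas mu h].

Definition fisher (mu : probability (borel M) R)
    (tau tau1 : set (borel M) -> \bar R) : R :=
  \int[mu]_x (RNd tau mu x * RNd tau1 mu x).

Definition fisher_norm (mu : probability (borel M) R)
    (tau : set (borel M) -> \bar R) : R :=
  Num.sqrt (fisher mu tau tau).

(* the value at [mu] of the Levi-Civita covariant derivative of the constant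
   vector field [tau1] in the direction [tau] *)
Definition levi_civita (mu : probability (borel M) R)
    (tau tau1 : set (borel M) -> \bar R) : set (borel M) -> \bar R :=
  wmeas mu (fun x =>
    - 2^-1 * (RNd tau mu x * RNd tau1 mu x - fisher mu tau tau1)).

(* Derivatives relative to a set [D]; for [D] a compact interval they are
   one-sided at the end points. *)
Definition slope_on (D : set R) (u : R -> R) (t : R) :=
  (fun s => (s - t)^-1 * (u s - u t)) @ within D (dnbhs t).

Definition derivable_on (D : set R) (u : R -> R) : Prop :=
  forall t, D t -> cvg (slope_on D u t).

Definition derive_on (D : set R) (u : R -> R) (t : R) : R :=
  lim (slope_on D u t).

Definition C2_on (D : set R) (u : R -> R) : Prop :=
  [/\ derivable_on D u, derivable_on D (derive_on D u) &
      {within D, continuous (derive_on D (derive_on D u))}].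

Section curves.
Variable lam : probability (borel M) R.
Implicit Types (a b : R) (c : R -> probability (borel M) R).

(* the function f(x,t) such that c(t) = f(.,t) lam *)
Definition curve_dens c (x : M) (t : R) : R := RNd (c t) lam x.

Definition velocity a b c (t : R) : set (borel M) -> \bar R :=
  wmeas lam (fun x => derive_on `[a, b] (curve_dens c x) t).

Definition acceleration a b c (t : R) : set (borel M) -> \bar R :=
  wmeas lam (fun x =>
    derive_on `[a, b] (derive_on `[a, b] (curve_dens c x)) t).

Definition is_curve a b c : Prop :=
  [/\ a < b,
      (forall t, t \in `[a, b] -> Pplus lam (c t)),
      (forall x, C2_on `[a, b] (curve_dens c x)) &
      (forall t, t \in `[a, b] -> tangent lam (velocity a b c t))].

Definition curve_length a b c : \bar R :=
  (\int[@lebesgue_measure R]_(t in `[a, b])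
     (fisher_norm (c t) (velocity a b c t))%:E)%E.

(* For s = [:: t_1; ...; t_k]: the restriction of [c] to each of
   [a, t_1], [t_1, t_2], ..., [t_(k-1), t_k] is a curve. *)
Fixpoint is_pw_curve a (s : seq R) c : Prop :=
  if s is b :: s' then is_curve a b c /\ is_pw_curve b s' c else True.

Fixpoint pw_length a (s : seq R) c : \bar R :=
  (if s is b :: s' then curve_length a b c + pw_length b s' c else 0)%E.

Definition joins a (s : seq R) c (mu mu1 : probability (borel M) R) : Prop :=
  [/\ s <> [::], is_pw_curve a s c, c a =m mu & c (last a s) =m mu1].

Definition fisher_dist (mu mu1 : probability (borel M) R) : \bar R :=
  ereal_inf [set L | exists a s c,
    joins a s c mu mu1 /\ L = pw_length a s c].

Definition shortest_path a (s : seq R) c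
    (mu mu1 : probability (borel M) R) : Prop :=
  joins a s c mu mu1 /\ pw_length a s c = fisher_dist mu mu1.

(* The covariant derivative of the velocity along [c] is the sum of the
   acceleration and of the connection term for constant vector fields. *)
Definition geodesic a b c : Prop :=
  is_curve a b c /\
  forall t, t \in `[a, b] ->
    (fun A => acceleration a b c t A +
       levi_civita (c t) (velocity a b c t) (velocity a b c t) A)%E
    =m (fun=> 0%E).

Definition unit_geodesic_segment (l : R) c
    (mu mu1 : probability (borel M) R) : Prop :=
  [/\ geodesic 0 l c, c 0 =m mu, c l =m mu1,
      fisher_norm mu (velocity 0 l c 0) = 1 &
      (forall t, t \in `[0, l] -> Pplus lam (c t))].

End curves.

Definition ell (mu mu1 : probability (borel M) R) : R :=
  xget 0 [set l : R | 0 <= l < pi /\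
    cos (l / 2) = \int[mu]_x Num.sqrt (RNd mu1 mu x)].

Definition geom_mean (mu mu1 : probability (borel M) R) :
    set (borel M) -> \bar R :=
  wmeas mu (fun x => (cos (ell mu mu1 / 2))^-1 * Num.sqrt (RNd mu1 mu x)).

(* the initial velocity (sigma(mu, mu1) - mu) / tan (ell / 2) *)
Definition init_velocity (mu mu1 : probability (borel M) R) :
    set (borel M) -> \bar R :=
  fun A => ((tan (ell mu mu1 / 2))^-1%:E * (geom_mean mu mu1 A - mu A))%E.

End statistical_manifold.

Notation "m1 =m m2" := (eqm m1 m2) (at level 70).

(* Main.v *)
From HB Require Import structures.
Require Import Defs.
From mathcomp Require Import all_boot all_order all_algebra.
From mathcomp Require Import all_classical all_reals all_analysis.
From mathcomp Require Import measurable_realfun ring lra.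

(** The map sending [f lam] to the square root of [f] identifies the measures
    with positive continuous densities with the positive continuous functions
    on the unit sphere of L2(lam), and the Fisher metric with four times the
    L2 metric.
    Distances become twice the angles, which is [ell] ([ellE]), and geodesics
    become great circles run at half unit speed.  Densities are continuous in
    space but only C2 in time for each fixed point, without uniformity, so
    differentiation under the integral sign is not available; the three parts
    of the proof are arranged to do without it.

    Lower bound.  For times [s < t] of a curve with square roots [q], the
    L2 norm of [q_t - q_s] is at most half the length of the arc between
    them: this follows from Tonelli's theorem and the Cauchy-Schwarz
    inequality ([chord_le_length]).  Short chords and the angles that they
    span are asymptotically equal, so subdividing the time interval shows
    that twice the angle between the end points is at most the length
    ([angle_le_length]); the triangle inequality for angles treats
    piecewise curves ([ell_le_fisher_dist]).

    Existence.  The great circle from one root to the other stays positive,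
    and a direct computation shows that its square is a geodesic of unit
    speed and of length [ell] ([circle_geodesic], [circle_length]).

    Uniqueness.  Along a geodesic [q'' = - (k / 4) q] almost everywhere,
    where [k] is the squared speed.  Hence the Wronskian of [q x] and [q y]
    is constant in time for almost all [x] and [y]
    ([regular_wronskian_const]).  The double integral of its square is twice
    the Gram determinant of [q] and [q'], that is [k / 2], so [k] is constant
    ([energy_const]).  With [k = 1] the equation becomes that of a harmonic
    oscillator, whose solution is determined by its values at the times [0]
    and [ell] ([regular_solution]).  Statements that hold almost everywhere
    about continuous functions hold everywhere because volume measures charge
    every nonempty open set ([volume_full_support]). *)

Set Implicit Arguments.
Unset Strict Implicit.
Unset Printing Implicit Defensive.

Import Order.TTheory GRing.Theory Num.Theory.
Import numFieldNormedType.Exports.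
Import HBNNSimple.

Local Open Scope classical_set_scope.
Local Open Scope ring_scope.

(** * Full support of the volume measure *)

Lemma lift0_rshift n (j : 'I_n) : @lift n.+1 ord0 j = rshift 1 j.
Proof. exact: ord_inj. Qed.

Lemma ord0_lshift n : @ord0 n = lshift n (@ord0 0).
Proof. exact: ord_inj. Qed.

Section iint.
Context {R : realType}.
Local Open Scope ereal_scope.

(** Neither function is assumed measurable: the integral of a nonnegative
    function is the supremum of the integrals of the simple functions below it.
    The inner integrals of an iterated integral come with no measurability
    statement, so this form is the one that iterates. *)
Lemma ge0_le_integralT d (T : measurableType d) (mu : {measure set T -> \bar R})
    (f g : T -> \bar R) :
  (forall x, 0 <= f x) -> (forall x, f x <= g x) ->
  \int[mu]_x f x <= \int[mu]_x g x.
Proof.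
move=> f0 fg; rewrite !ge0_integralTE//; last first.
  by move=> x; exact: le_trans (f0 x) (fg x).
apply: ereal_sup_le => _ [h /= hf <-]; exists h => // x.
exact: le_trans (hf x) (fg x).
Qed.

Lemma lebesgue_iint_ge0 n (g : 'rV[R]_n -> \bar R) :
  (forall y, 0 <= g y) -> 0 <= lebesgue_iint g.
Proof.
elim: n g => [|n IH] g g0 /=; first exact: g0.
by apply: integral_ge0 => t _; apply: IH.
Qed.

(** By induction on the dimension: the inner integral over the remaining
    coordinates is at least [e * (2 r) ^ n] for every first coordinate in an
    interval of length [2 r]. *)
Lemma lebesgue_iint_box n (g : 'rV[R]_n -> \bar R) (y : 'rV[R]_n) (r e : R) :
  (0 < r)%R -> (0 < e)%R -> (forall v, 0 <= g v) ->
  (forall v : 'rV[R]_n, (forall i, `|v 0 i - y 0 i| < r)%R -> e%:E <= g v) ->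
  (e * (r *+ 2) ^+ n)%:E <= lebesgue_iint g.
Proof.
move=> r0; elim: n g y e => [|n IH] g y e e0 g0 gy.
  by rewrite expr0 mulr1 /=; apply: gy => -[].
rewrite /=.
pose y0 := y ord0 ord0.
have E : \int[@lebesgue_measure R]_(t in `](y0 - r)%R, (y0 + r)%R[)
   (e * (r *+ 2) ^+ n)%:E = (e * (r *+ 2) ^+ n.+1)%:E.
  rewrite integral_cst//=.
  rewrite lebesgue_measure_itv/= lte_fin ltrBlDr -addrA ltrDl -mulr2n pmulrn_lgt0//.
  rewrite r0 -EFinB -EFinM; congr EFin.
  by rewrite opprB addrC addrA subrK -mulr2n exprSr mulrA.
rewrite -E integral_mkcond; apply: ge0_le_integralT => t.
  rewrite /patch; case: ifP => // _; rewrite lee_fin.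
  by rewrite mulr_ge0 ?(ltW e0)// exprn_ge0// mulrn_wge0// ltW.
rewrite /patch; case: ifPn => [|_]; last by apply: lebesgue_iint_ge0.
rewrite inE/= in_itv/= => tI.
apply: (IH _ (\row_j y ord0 (lift ord0 j)) e e0) => // v vy.
apply: gy => i.
case: (unliftP ord0 i) => [/= j ->|->].
  have vj := row_mxEr (const_mx t : 'rV[R]_1) v ord0 j.
  by have := vy j; rewrite mxE -vj -lift0_rshift.
rewrite ord0_lshift.
have /= -> := row_mxEl (const_mx t : 'rV[R]_1) v ord0 ord0.
by rewrite mxE -ord0_lshift ltr_distl.
Qed.

End iint.

Section continuous_functions.
Context {R : realType} {M : ptopologicalType}.

Lemma open_borel (U : set M) : open U -> measurable (U : set (borel M)).
Proof. by move=> oU; apply: sub_sigma_algebra. Qed.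

Lemma continuous_borel (h : M -> R) :
  continuous h -> measurable_fun [set: borel M] h.
Proof.
move=> ch; apply: (measurability _ (RGenOInfty.measurableE R)).
move=> _ [_ [a ->] <-]; rewrite setTI; apply: open_borel.
by move/continuousP : ch; apply; exact: interval_open.
Qed.

Lemma compact_bounded_continuous (h : M -> R) :
  compact [set: M] -> continuous h -> exists2 K : R, 0 < K & forall x, `|h x| <= K.
Proof.
move=> cM ch.
have /compact_bounded[K [_ HK]] :
    compact (h @` [set: M]).
  by apply: continuous_compact => //; exact: continuous_subspaceT.
exists (`|K| + 1); first by rewrite ltr_wpDl.
move=> x; apply: HK; last by exists x.
by rewrite (le_lt_trans (ler_norm _))// ltrDl.
Qed.

End continuous_functions.

(** The contribution of the volume form: positivity on open sets makes
    continuous Radon-Nikodym derivatives unique at every point. *)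
Definition full_support {R : realType} {M : ptopologicalType}
  (lam : probability (borel M) R) :=
  forall U : set M, open U -> U !=set0 -> (0 < lam U)%E.

(** In a chart around a point of [U] the coefficient of the volume form is
    bounded away from zero on a small cube mapped into [U]; the Lebesgue volume
    of that cube bounds the measure of [U] from below. *)
Lemma volume_full_support (R : realType) (n : nat) (M : ptopologicalType)
    (X : smooth_manifold R n M) (w : volume_form X)
    (lam : probability (borel M) R) :
  is_volume_measure w lam -> full_support lam.
Proof.
move=> lamE U oU [x Ux].
have [c Xc cx] := atlas_cover X x.
pose V := U `&` chart_dom c.
have oV : open V by apply: openI => //; exact: chart_dom_open.
apply: (@lt_le_trans _ _ (lam V)); last first.
  by apply: le_measure; rewrite ?inE; [exact: open_borel|exact: open_borel|exact: subIsetl].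
rewrite (lamE c Xc V (open_borel oV))//; last exact: subIsetr.
have [cy fK] := chart_funP cx.
set y := chart_fun c x in cy fK *.
set v := vol_coef w c.
have vy0 : 0 < `|v y| by rewrite normr_gt0 vol_neq0.
have cv : {for y, continuous v}.
  by have [+ _] := vol_smooth w Xc 0%N; apply.
have near1 : \forall z \near y, chart_cod c z.
  by apply: open_nbhs_nbhs; split => //; exact: chart_cod_open.
have near2 : \forall z \near y, V (chart_inv c z).
  have ci := chart_inv_continuous cy.
  by apply: ci; rewrite fK; exact: open_nbhs_nbhs.
have near3 : \forall z \near y, `|v y| / 2 < `|v z|.
  have cn : {for y, continuous (@Num.norm R R \o v)}.
    by apply: continuous_comp => //; exact: norm_continuous.
  by apply: (cvgr_gt _ cn); rewrite ltr_pdivrMr// ltr_pMr// ltr1n.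
have : \forall z \near y, [/\ chart_cod c z, V (chart_inv c z) & `|v y| / 2 < `|v z|].
  by near=> z; split; near: z.
move=> /nbhs_ballP[r/= r0 ry].
have e0 : 0 < `|v y| / 2 by rewrite divr_gt0.
set g := fun _ => if _ then _ else _.
have := @lebesgue_iint_box _ n g y r (`|v y| / 2) r0 e0.
move=> H; apply: (lt_le_trans _ (H _ _)).
- by rewrite lte_fin mulr_gt0// exprn_gt0// pmulrn_lgt0.
- by move=> z; rewrite /g; case: ifP.
- move=> z zr.
  have [z1 z2 z3] : [/\ chart_cod c z, V (chart_inv c z) & `|v y| / 2 < `|v z|].
    apply: ry; split=> // i j; rewrite (ord1 i); have := zr j.
    by rewrite /ball/= distrC.
  rewrite /g ifT; first by rewrite lee_fin ltW.
  by rewrite inE.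
Unshelve. all: by end_near. Qed.

Section full_support_theory.
Context {R : realType} {M : ptopologicalType} (lam : probability (borel M) R).
Hypotheses (cM : compact [set: M]) (lam_full : full_support lam).

Lemma continuous_integrable (h : M -> R) (A : set (borel M)) :
  continuous h -> measurable A -> lam.-integrable A (EFin \o h).
Proof.
move=> ch mA; have [K K0 hK] := compact_bounded_continuous cM ch.
apply: (@integrableS _ _ _ _ setT) => //.
apply: (@le_integrable _ _ _ _ _ _ _ (EFin \o cst K)) => //.
- by apply/measurable_EFinP; exact: continuous_borel.
- by move=> x _ /=; rewrite lee_fin (ger0_norm (ltW K0)).
- exact: finite_measure_integrable_cst.
Qed.

(** Sets of full measure are dense, because their complements cannot contain a
    nonempty open set. *)
Lemma ae_exists_near (P : set M) (x : M) (U : set M) :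
  {ae lam, forall x, P x} -> nbhs x U -> exists2 y, U y & P y.
Proof.
move=> [N [mN N0 PN]]; rewrite nbhsE => -[V [oV Vx] VU].
apply: contrapT => /forall2NP UP.
have VN : V `<=` N by move=> z Vz; apply: PN => /= Pz; case: (UP z); auto.
have : (lam V <= lam N)%E.
  by apply: le_measure; rewrite ?inE//; exact: open_borel.
by rewrite N0 leNgt lam_full//; exists x.
Qed.

Lemma continuous_ae_eq (h1 h2 : M -> R) :
  continuous h1 -> continuous h2 -> {ae lam, forall x, h1 x = h2 x} ->
  h1 = h2.
Proof.
move=> c1 c2 h12; apply/funext => x; apply/eqP; apply: contrapT => /negP neq.
have : \forall y \near x, h1 y - h2 y != 0.
  have cB : (h1 y - h2 y) @[y --> x] --> h1 x - h2 x by apply: cvgB; [exact: c1|exact: c2].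
  by apply: (cvgr_neq0 _ cB); rewrite subr_eq0.
move=> /(ae_exists_near h12)[y]; rewrite subr_eq0 => /eqP + /= yE.
by rewrite yE.
Qed.

(** The function [g] is only measurable: it will be a time derivative of a
    density, whose regularity in space is known merely through the measure that
    it defines. *)
Lemma wmeas_ae_eq (g h : M -> R) :
  measurable_fun [set: borel M] g -> continuous h ->
  wmeas lam g =m wmeas lam h -> {ae lam, forall x, g x = h x}.
Proof.
move=> mg ch gh.
have : ae_eq lam setT (EFin \o h) (EFin \o g).
  apply: integral_ae_eq => //.
  - exact: continuous_integrable.
  - exact/measurable_EFinP.
  - by move=> E _ mE; rewrite -[LHS]gh.
by apply: filterS => x /(_ I) [].
Qed.

Lemma wmeas_inj (g h : M -> R) : continuous g -> continuous h ->
  wmeas lam g =m wmeas lam h -> g = h.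
Proof.
move=> cg ch gh; apply: continuous_ae_eq => //.
by apply: wmeas_ae_eq => //; exact: continuous_borel.
Qed.

End full_support_theory.

(** * Square-integrable continuous functions and densities *)

Section continuity_closure.
Context {R : realType} {T : topologicalType}.
Implicit Types f g : T -> R.

Lemma contC (c : R) : continuous (fun _ : T => c).
Proof. by move=> x; exact: cvg_cst. Qed.

Lemma contD f g : continuous f -> continuous g -> continuous (fun x => f x + g x).
Proof. by move=> cf cg x; apply: cvgD; [exact: cf|exact: cg]. Qed.

Lemma contB f g : continuous f -> continuous g -> continuous (fun x => f x - g x).
Proof. by move=> cf cg x; apply: cvgB; [exact: cf|exact: cg]. Qed.

Lemma contM f g : continuous f -> continuous g -> continuous (fun x => f x * g x).
Proof. by move=> cf cg x; apply: cvgM; [exact: cf|exact: cg]. Qed.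

Lemma contX f n : continuous f -> continuous (fun x => f x ^+ n).
Proof.
move=> cf; elim: n => [|n IH]; first exact: contC.
by under eq_fun do rewrite exprS; exact: contM.
Qed.

Lemma contV f : (forall x, f x != 0) -> continuous f ->
  continuous (fun x => (f x)^-1).
Proof. by move=> f0 cf x; apply: cvgV => //; exact: cf. Qed.

Lemma cont_sqrt f : continuous f -> continuous (fun x => Num.sqrt (f x)).
Proof.
by move=> cf x; apply: (continuous_comp (cf x)); exact: sqrt_continuous.
Qed.

End continuity_closure.

Section integration.
Context {R : realType} {M : ptopologicalType} (lam : probability (borel M) R).
Hypothesis (cM : compact [set: M]).

Lemma RintD (f g : M -> R) : continuous f -> continuous g ->
  \int[lam]_x (f x + g x) = \int[lam]_x f x + \int[lam]_x g x.
Proof. by move=> cf cg; apply: RintegralD => //; exact: continuous_integrable. Qed.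

Lemma RintZ (c : R) (f : M -> R) : continuous f ->
  \int[lam]_x (c * f x) = c * \int[lam]_x f x.
Proof. by move=> cf; apply: RintegralZl => //; exact: continuous_integrable. Qed.

Lemma Rint_ge0 (f : M -> R) : (forall x, 0 <= f x) -> 0 <= \int[lam]_x f x.
Proof. by move=> f0; apply: Rintegral_ge0. Qed.

Lemma EFin_Rint (f : M -> R) : continuous f ->
  (\int[lam]_x f x)%:E = (\int[lam]_x (f x)%:E)%E.
Proof.
move=> cf; rewrite fineK//; apply: integrable_fin_num => //.
exact: continuous_integrable.
Qed.

Lemma wmeas_fin (f : M -> R) (A : set (borel M)) : continuous f ->
  measurable A -> wmeas lam f A \is a fin_num.
Proof.
by move=> cf mA; apply: integrable_fin_num => //; exact: continuous_integrable.
Qed.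

Lemma wmeasD (f g : M -> R) A : continuous f -> continuous g ->
  measurable A ->
  wmeas lam (fun x => f x + g x) A = (wmeas lam f A + wmeas lam g A)%E.
Proof.
move=> cf cg mA; rewrite /wmeas -integralD//=; last 2 first.
- exact: continuous_integrable.
- exact: continuous_integrable.
Qed.

Lemma wmeasZ (c : R) (f : M -> R) A : continuous f -> measurable A ->
  wmeas lam (fun x => c * f x) A = (c%:E * wmeas lam f A)%E.
Proof.
move=> cf mA; rewrite /wmeas -integralZl//=; exact: continuous_integrable.
Qed.

Lemma Rint_cst (c : R) : \int[lam]_x c = c.
Proof.
rewrite Rintegral_cst//.
transitivity (c * fine (1 : \bar R)%E); last by rewrite mulr1.
by congr (c * fine _); exact: probability_setT.
Qed.

(** The inner product of L2(lam), used for continuous functions, on which it is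
    finite and bilinear. *)
Definition ip (u v : M -> R) : R := \int[lam]_x (u x * v x).

Lemma ipC u v : ip u v = ip v u.
Proof. by apply: eq_Rintegral => x _; rewrite mulrC. Qed.

Lemma ip_ge0 u : 0 <= ip u u.
Proof. by apply: Rint_ge0 => x; rewrite -expr2 sqr_ge0. Qed.

Lemma ip_lin u v w (a b : R) : continuous u -> continuous v -> continuous w ->
  ip (fun x => a * u x + b * v x) w = a * ip u w + b * ip v w.
Proof.
move=> cu cv cw; rewrite -!RintZ//; [|exact: contM..].
rewrite -RintD; first by apply: eq_Rintegral => x _ /=; ring.
all: by do 2?[apply: contM => //]; exact: contC.
Qed.

Lemma ip_sqr u v (a b : R) : continuous u -> continuous v ->
  ip (fun x => a * u x + b * v x) (fun x => a * u x + b * v x) =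
  a ^+ 2 * ip u u + 2 * a * b * ip u v + b ^+ 2 * ip v v.
Proof.
move=> cu cv.
have c : continuous (fun x => a * u x + b * v x).
  by apply: contD; apply: contM => //; exact: contC.
rewrite ip_lin// (ipC u) (ipC v) !ip_lin// (ipC v u); ring.
Qed.

(** The quadratic form [a^2 (u,u) + 2 a b (u,v) + b^2 (v,v)] is nonnegative;
    its value at [a = (v,v)], [b = - (u,v)] gives the claim when [v] is not null,
    and an affine form bounded below is constant otherwise. *)
Lemma ip_cauchy_schwarz u v : continuous u -> continuous v ->
  ip u v ^+ 2 <= ip u u * ip v v.
Proof.
move=> cu cv.
have H a b : 0 <= a ^+ 2 * ip u u + 2 * a * b * ip u v + b ^+ 2 * ip v v.
  by rewrite -ip_sqr//; exact: ip_ge0.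
have [v0|v0] := eqVneq (ip v v) 0.
  have [-> |uv0] := eqVneq (ip u v) 0; first by rewrite v0; lra.
  have := H 1 (- (ip u u + 1) / (2 * ip u v)).
  rewrite v0 (_ : 2 * 1 * _ * _ = - (ip u u + 1)); last by field.
  have := ip_ge0 u; lra.
have vp : 0 < ip v v by rewrite lt0r v0 ip_ge0.
have := H (ip v v) (- ip u v).
rewrite (_ : _ + _ = ip v v * (ip u u * ip v v - ip u v ^+ 2)); last by ring.
by rewrite pmulr_rge0// subr_ge0.
Qed.

End integration.

Section densities.
Context {R : realType} {M : ptopologicalType} (lam : probability (borel M) R).
Hypotheses (cM : compact [set: M]) (lam_full : full_support lam).

Definition is_density (m : set (borel M) -> \bar R) (f : M -> R) :=
  [/\ continuous f, (forall x, 0 < f x) & m =m wmeas lam f].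

Lemma PplusP (m : probability (borel M) R) :
  Pplus lam m <-> exists f, is_density m f.
Proof.
split=> [[f [cf f0 _ mf]]|[f [cf f0 mf]]]; first by exists f.
by exists f; split => //; rewrite -mf//; exact: probability_setT.
Qed.

Lemma density_int1 (m : probability (borel M) R) f :
  is_density m f -> \int[lam]_x f x = 1.
Proof.
move=> [cf f0 mf]; transitivity (fine (wmeas lam f setT)) => //.
rewrite -mf//; transitivity (fine (1 : \bar R)%E) => //.
by congr fine; exact: probability_setT.
Qed.

(** Change of variables for the Radon-Nikodym derivative of [m], which is equal
    to [f] almost everywhere. *)
Lemma wmeas_density (m : probability (borel M) R) f g :
  is_density m f -> continuous g ->
  wmeas m g =m wmeas lam (fun x => g x * f x).
Proof.
move=> [cf f0 mf] cg A mA; rewrite /wmeas.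
have mlam : m `<< lam.
  apply/null_content_dominatesP => B mB lB; rewrite mf//.
  apply: null_set_integral => //.
  by apply/measurable_funTS/measurable_EFinP; exact: continuous_borel.
rewrite -(Radon_Nikodym_change_of_variables mlam)//; last exact: continuous_integrable.
apply: ae_eq_integral => //.
- apply: emeasurable_funM.
    by apply/measurable_funTS/measurable_EFinP; exact: continuous_borel.
  exact: measurable_funTS.
- by apply/measurable_funTS/measurable_EFinP; apply: continuous_borel; exact: contM.
- have : ae_eq lam setT (EFin \o f) (Radon_Nikodym (charge_of_finite_measure m) lam).
    apply: integral_ae_eq => //.
    - exact: continuous_integrable.
    - by move=> E _ mE; rewrite -Radon_Nikodym_integral// -[LHS]mf.
  by apply: filterS => x /= /(_ I) <- _; rewrite EFinM.
Qed.

Lemma Rint_density (m : probability (borel M) R) f g :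
  is_density m f -> continuous g ->
  \int[m]_x g x = \int[lam]_x (g x * f x).
Proof. by move=> mf cg; rewrite /Rintegral; congr fine; apply: (wmeas_density mf). Qed.

(** Continuous derivatives are unique by full support, so [RNd], defined by
    choice, is the quotient of the two densities. *)
Lemma RNd_eq (tau : set (borel M) -> \bar R) (m : probability (borel M) R) f h :
  is_density m f -> continuous h -> tau =m wmeas lam h ->
  RNd tau m = fun x => h x / f x.
Proof.
move=> mf ch th; have [cf f0 mE] := mf.
have chf : continuous (fun x => h x / f x).
  by apply: contM => //; apply: contV => // x; rewrite gt_eqF.
have f0' x : f x != 0 by rewrite gt_eqF.
rewrite /RNd; case: xgetP => [k _ [ck tk]|/(_ (fun x => h x / f x))[]]; last first.
  split => // A mA; rewrite (wmeas_density mf)// th//.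
  by apply: eq_integral => x _; rewrite divfK.
have kf : (fun x => k x * f x) = h.
  apply: (wmeas_inj cM lam_full) => //; first exact: contM.
  by move=> A mA; rewrite -(wmeas_density mf)// -tk// th.
by apply/funext => x; rewrite -kf mulfK.
Qed.

Lemma is_density_lam : is_density lam (fun=> 1).
Proof.
split => //; first exact: contC.
by move=> A mA; rewrite /wmeas integral_cst// mul1e.
Qed.

Lemma RNd_density (m : set (borel M) -> \bar R) f :
  is_density m f -> RNd m lam = f.
Proof.
move=> [cf f0 mf]; rewrite (RNd_eq is_density_lam cf mf).
by apply/funext => x; rewrite divr1.
Qed.

Lemma fisher_eq (m : probability (borel M) R) f tau tau1 h h1 :
  is_density m f -> continuous h -> tau =m wmeas lam h ->
  continuous h1 -> tau1 =m wmeas lam h1 ->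
  fisher m tau tau1 = \int[lam]_x (h x * h1 x / f x).
Proof.
move=> mf ch th ch1 th1; have [cf f0 mE] := mf.
have f0' x : f x != 0 by rewrite gt_eqF.
rewrite /fisher (RNd_eq mf ch th) (RNd_eq mf ch1 th1) (Rint_density mf).
  by apply: eq_Rintegral => x _; have := f0' x => ?; field.
by do 2?[apply: contM => //]; exact: contV.
Qed.

End densities.

Section density_measure.
Context {R : realType} {M : ptopologicalType} (lam : probability (borel M) R).
Variable f : M -> R.
Hypotheses (cf : continuous f) (f0 : forall x, 0 < f x).
Hypothesis f1 : wmeas lam f setT = 1%E.

(** The hypotheses are arguments so that the measure and probability
    structures can be inferred from the term. *)
Definition density_measure of continuous f & (forall x, 0 < f x) &
  wmeas lam f setT = 1%E := wmeas lam f.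

Local Notation m := (density_measure cf f0 f1).

Let m0 : m set0 = 0%E. Proof. exact: integral_set0. Qed.

Let m_ge0 A : (0 <= m A)%E.
Proof. by apply: integral_ge0 => x _; rewrite lee_fin ltW. Qed.

Let m_sigma_additive : semi_sigma_additive m.
Proof.
apply: semi_sigma_additive_nng_induced; last by move=> x; rewrite lee_fin ltW.
by apply/measurable_EFinP; exact: continuous_borel.
Qed.

HB.instance Definition _ := isMeasure.Build _ _ _ m m0 m_ge0 m_sigma_additive.
HB.instance Definition _ := Measure_isProbability.Build _ _ _ m f1.

Lemma probability_of_wmeas :
  exists m : probability (borel M) R, is_density lam m f.
Proof. by exists m. Qed.

End density_measure.

(** * Derivatives relative to a compact interval *)

Section derive_on_theory.
Context {R : realType}.
Implicit Types (u v : R -> R) (D : set R) (a b t : R).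

Lemma slope_on_eq D u v t : {in D, u =1 v} -> D t ->
  slope_on D u t = slope_on D v t.
Proof.
move=> uv Dt; apply/seteqP; rewrite /slope_on /=.
have H w z (P : set R) : {in D, w =1 z} ->
    (((fun s => (s - t)^-1 * (w s - w t)) @ within D (dnbhs t)) : set_system R) P ->
    (((fun s => (s - t)^-1 * (z s - z t)) @ within D (dnbhs t)) : set_system R) P.
  move=> wz; rewrite /nbhs /= /within /=; apply: filterS => s /= Ps sD.
  by rewrite -!wz ?inE//; exact: Ps.
split=> P; first exact: H.
by apply: H => x xD; rewrite uv.
Qed.

Lemma itv_proper a b t : a < b -> t \in `[a, b] ->
  ProperFilter (within `[a, b] (dnbhs t)).
Proof.
move=> ab; rewrite in_itv/= => /andP[at_ tb].
split; last exact: within_filter.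
rewrite /within/= => -[e/= e0 H].
(* A point to the right of [t] if there is room, to the left otherwise. *)
have [ta|] := ltP t b.
  pose s := t + Num.min (e / 2) (b - t).
  have m0 : 0 < Num.min (e / 2) (b - t).
    by rewrite lt_min divr_gt0//= subr_gt0.
  apply: (H s) => /=.
  - rewrite /ball/= /s opprD addrA subrr add0r normrN gtr0_norm//.
    by rewrite gt_min ltr_pdivrMr// ltr_pMr// ltr1n.
  - by rewrite /s gt_eqF// ltrDl.
  - rewrite /= in_itv/= (le_trans at_)/=; last by rewrite /s lerDl ltW.
    by rewrite /s -lerBrDl ge_min lexx orbT.
move=> bt; have {bt tb}tE : t = b by apply/eqP; rewrite eq_le tb.
subst t.
pose s := b - Num.min (e / 2) (b - a).
have m0 : 0 < Num.min (e / 2) (b - a).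
  by rewrite lt_min divr_gt0//= subr_gt0.
apply: (H s) => /=.
- rewrite /ball/= /s opprD addrA subrr add0r opprK gtr0_norm//.
  by rewrite gt_min ltr_pdivrMr// ltr_pMr// ltr1n.
- by rewrite /s lt_eqF// ltrBlDr ltrDl.
- rewrite /= in_itv/= /s; apply/andP; split; last by rewrite lerBlDr lerDl ltW.
  by rewrite lerBrDl -lerBrDr ge_min lexx orbT.
Qed.

(** Passes from increments [h] tending to 0 to points [s] tending to [t], the
    form in which derivatives relative to an interval are given. *)
Lemma dnbhs_slope u t d : is_derive t 1 u d <->
  (fun s => (s - t)^-1 * (u s - u t)) @ dnbhs t --> d.
Proof.
set F := fun s => _.
set G := fun h : R => h^-1 *: ((u \o shift t) (h *: 1) - u t).
have FG s : F s = G (s - t).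
  by rewrite /F /G/= /GRing.scale/= mulr1 subrK.
have E : F @ dnbhs t --> d <-> G @ 0^' --> d.
  split=> /cvgrPdist_lt H; apply/cvgrPdist_lt => e e0;
    have [r/= r0 rH] := H e e0; exists r => //= s /= sr s0.
  - rewrite -(addrK t s) -FG; apply: rH => /=.
      by move: sr; rewrite /ball/= sub0r normrN opprD addrCA subrr addr0 normrN.
    by rewrite -subr_eq0 addrK.
  - rewrite FG; apply: rH => /=; last by rewrite subr_eq0.
    by move: sr; rewrite /ball/= sub0r normrN distrC.
rewrite E; split.
- by move=> [du <-].
- move=> Gd; have dc : derivable u t 1 by apply/cvg_ex; exists d.
  by apply: DeriveDef => //; exact: cvg_lim.
Qed.

Lemma is_derive_slope_on a b u t d : is_derive t 1 u d ->
  slope_on `[a, b] u t --> d.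
Proof.
move=> /dnbhs_slope; apply: cvg_trans; apply: cvg_app; exact: cvg_within.
Qed.

Lemma slope_on_cvg a b u t d : a < b -> t \in `[a, b] ->
  slope_on `[a, b] u t --> d ->
  cvg (slope_on `[a, b] u t) /\ derive_on `[a, b] u t = d.
Proof.
move=> ab tab ud; split; first by apply/cvg_ex; exists d.
have ? := itv_proper ab tab.
by apply: cvg_lim => //.
Qed.

(** Near an interior point the restriction to the interval is vacuous. *)
Lemma is_derive_derive_on a b u t : t \in `]a, b[ ->
  cvg (slope_on `[a, b] u t) -> is_derive t 1 u (derive_on `[a, b] u t).
Proof.
move=> tab c; apply/dnbhs_slope; apply: cvg_trans c.
move=> P; rewrite /slope_on /nbhs/= /within/= => H.
have : \forall s \near dnbhs t, s \in `[a, b].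
  apply: nbhs_dnbhs; apply: filterS (near_in_itvoo tab) => s.
  exact: subset_itv_oo_cc.
by apply: filterS2 H => s /= /[apply].
Qed.

Lemma derivable_on_within a b u : derivable_on `[a, b] u ->
  forall t, t \in `[a, b] -> u @ within `[a, b] (nbhs t) --> u t.
Proof.
move=> du t tab; have /cvg_ex[d dE] := du t tab.
have Fle : within `[a, b] (dnbhs t) `=>` nbhs t.
  by move=> P /nbhs_dnbhs; exact: cvg_within.
have H : (fun s => (s - t) * ((s - t)^-1 * (u s - u t)) + u t) @
    within `[a, b] (dnbhs t) --> 0 * d + u t.
  apply: cvgD; last exact: cvg_cst.
  apply: cvgM; last exact: dE.
  have -> : 0 = t - t by rewrite subrr.
  by apply: cvgB; [exact: Fle|exact: cvg_cst].
move=> P; rewrite -[X in nbhs X _](add0r (u t)) -[X in X + _](mul0r d) => Pu.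
have H' : \forall s \near t, s != t -> s \in `[a, b] ->
  P ((s - t) * ((s - t)^-1 * (u s - u t)) + u t) by exact: H.
suff : \forall s \near t, s \in `[a, b] -> P (u s) by [].
apply: filterS H' => s H' sab.
have [->|st] := eqVneq s t.
  by move: Pu; rewrite mul0r add0r => /nbhs_singleton.
by have := H' st sab; rewrite mulrA divff ?subr_eq0// mul1r subrK.
Qed.

End derive_on_theory.

Section interval_calculus.
Context {R : realType}.
Implicit Types (u v : R -> R) (a b s t : R).

(** Continuity on [[a, b]] stated point by point, so that the limit rules for
    sums, products and inverses apply directly at the end points too. *)
Definition cont_itv a b u :=
  forall t, t \in `[a, b] -> u @ within `[a, b] (nbhs t) --> u t.

Lemma cont_itvP a b u : cont_itv a b u <-> {within `[a, b], continuous u}.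
Proof. by split=> [H|/subspace_continuousP H]; [apply/subspace_continuousP|]. Qed.

Lemma cont_itv_sub a b a' b' u : a <= a' -> b' <= b ->
  cont_itv a b u -> cont_itv a' b' u.
Proof.
move=> aa bb cu t tab; have sub : `[a', b'] `<=` `[a, b].
  by apply: subset_itv; rewrite bnd_simp.
apply: cvg_trans (cu t (sub t tab)); apply: cvg_app.
exact: within_subset.
Qed.

Definition clamp a b t := Num.max a (Num.min b t).

Lemma clamp_in a b t : a <= b -> clamp a b t \in `[a, b].
Proof.
by move=> ab; rewrite in_itv/= /clamp le_max lexx/= ge_max ab ge_min lexx.
Qed.

Lemma clamp_id a b t : t \in `[a, b] -> clamp a b t = t.
Proof.
by rewrite in_itv/= /clamp => /andP[at_ tb]; rewrite (min_idPr tb) (max_idPr at_).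
Qed.

(** Precomposition with the retraction of the line onto [[a, b]] turns
    continuity on the interval into plain continuity, as needed for measurability
    on the product with the line and for density arguments. *)
Lemma cont_clamp a b u : a <= b -> cont_itv a b u -> continuous (u \o clamp a b).
Proof.
move=> ab cu t.
have H : clamp a b @ t --> within `[a, b] (nbhs (clamp a b t)).
  have c : clamp a b @ t --> clamp a b t.
    apply: (@continuous_max _ _ (cst a) (fun t => Num.min b t)); first exact: cst_continuous.
    by apply: continuous_min; [exact: cst_continuous|exact: cvg_id].
  move=> P HP; have H : \forall s \near t,
    clamp a b s \in `[a, b] -> P (clamp a b s) by exact: (c _ HP).
  suff : \forall s \near t, P (clamp a b s) by [].
  by apply: filterS H => s Hs; apply: Hs; exact: clamp_in.
exact: cvg_comp H (cu _ (clamp_in t ab)).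
Qed.

Lemma const_of_derive0 a b u : a <= b -> cont_itv a b u ->
  (forall t, t \in `]a, b[ -> is_derive t 1 u 0) ->
  forall t, t \in `[a, b] -> u t = u a.
Proof.
move=> ab cu du t /[dup] tab; rewrite in_itv/= => /andP[at_ tb].
have dut x : x \in `]a, t[ -> is_derive x 1 u 0.
  by move=> xat; apply: du; move: xat; apply: subset_itvl; rewrite bnd_simp.
have cut : {within `[a, t], continuous u}.
  by apply/cont_itvP; exact: cont_itv_sub cu.
have [c _] := MVT_segment at_ dut cut.
by rewrite mul0r => /eqP; rewrite subr_eq0 => /eqP.
Qed.

Lemma FTC_itv a b u v : a <= b -> cont_itv a b u -> cont_itv a b v ->
  (forall t, t \in `]a, b[ -> is_derive t 1 u (v t)) ->
  (\int[lebesgue_measure]_(t in `[a, b]) (v t)%:E = (u b - u a)%:E)%E.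
Proof.
rewrite le_eqVlt => /predU1P[->|ab] cu cv du.
  by rewrite set_itv1 integral_set1 subrr.
rewrite (@continuous_FTC2 R v u a b ab) ?EFinB//.
- exact/cont_itvP.
- move/cont_itvP : cu => /(continuous_within_itvP _ ab)[_ ca cb].
  by split => // x xab; have [] := du x xab.
- by move=> x xab; rewrite derive1E; have ? := du x xab; rewrite derive_val.
Qed.

Section root.
Variables (a b : R) (u : R -> R).
Hypotheses (ab : a < b) (u2 : C2_on `[a, b] u).
Hypothesis (u0 : forall t, t \in `[a, b] -> 0 < u t).
Let u' := derive_on `[a, b] u.
Let u'' := derive_on `[a, b] u'.

(** Densities are studied through their square roots: on these the Fisher
    metric is four times the L2 metric.  [root_vel] and [root_acc] are the first
    two time derivatives of [root_val], one-sided at the end points. *)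
Definition root_val t := Num.sqrt (u t).
Definition root_vel t := u' t / (2 * root_val t).
Definition root_acc t := u'' t / (2 * root_val t) - u' t ^+ 2 / (4 * u t * root_val t).

Let cu : cont_itv a b u.
Proof. by case: u2 => du _ _; exact: derivable_on_within. Qed.

Lemma cont_derive_on : cont_itv a b u'.
Proof. by case: u2 => _ du _; exact: derivable_on_within. Qed.
Let cu' := cont_derive_on.

Let cu'' : cont_itv a b u''.
Proof. by case: u2 => _ _ /cont_itvP. Qed.

Lemma root_val_gt0 t : t \in `[a, b] -> 0 < root_val t.
Proof. by move=> tab; rewrite sqrtr_gt0 u0. Qed.

Lemma root_val_sqr t : t \in `[a, b] -> root_val t ^+ 2 = u t.
Proof. by move=> tab; rewrite sqr_sqrtr// ltW// u0. Qed.

Lemma cont_root_val : cont_itv a b root_val.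
Proof.
move=> t tab; apply: (cvg_comp _ _ (cu tab)).
exact: sqrt_continuous.
Qed.

Lemma cont_root_vel : cont_itv a b root_vel.
Proof.
move=> t tab; apply: cvgM; first exact: cu'.
apply: cvgV; first by rewrite mulf_neq0// gt_eqF// root_val_gt0.
by apply: cvgM; [exact: cvg_cst|exact: cont_root_val].
Qed.

Lemma cont_root_acc : cont_itv a b root_acc.
Proof.
have n0 t : t \in `[a, b] -> root_val t != 0 by move=> /root_val_gt0/gt_eqF ->.
move=> t tab; apply: cvgB; apply: cvgM.
- exact: cu''.
- apply: cvgV; first by rewrite mulf_neq0// n0.
  by apply: cvgM; [exact: cvg_cst|exact: cont_root_val].
- by rewrite [in X in _ --> X]expr2; under eq_fun do rewrite expr2; apply: cvgM; exact: cu'.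
- apply: cvgV; first by rewrite !mulf_neq0// ?n0// gt_eqF// u0.
  apply: cvgM; last exact: cont_root_val.
  by apply: cvgM; [exact: cvg_cst|exact: cu].
Qed.

Lemma is_derive_u t : t \in `]a, b[ -> is_derive t 1 u (u' t).
Proof.
case: u2 => du _ _ tab; apply: is_derive_derive_on => //.
by apply: du; exact: subset_itv_oo_cc.
Qed.

Lemma is_derive_u' t : t \in `]a, b[ -> is_derive t 1 u' (u'' t).
Proof.
case: u2 => _ du _ tab; apply: is_derive_derive_on => //.
by apply: du; exact: subset_itv_oo_cc.
Qed.

Lemma is_derive_root_val t : t \in `]a, b[ -> is_derive t 1 root_val (root_vel t).
Proof.
move=> tab; have tab' : t \in `[a, b] by exact: subset_itv_oo_cc.
have ? := is_derive_u tab.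
have ? := is_derive1_sqrt (u0 tab').
rewrite /root_vel mulrC.
by apply: (@is_derive1_comp _ Num.sqrt u).
Qed.

Lemma is_derive_root_vel t : t \in `]a, b[ -> is_derive t 1 root_vel (root_acc t).
Proof.
move=> tab; have tab' : t \in `[a, b] by exact: subset_itv_oo_cc.
have ? := is_derive_u' tab.
have ? := is_derive_root_val tab.
have q0 : root_val t != 0 by rewrite gt_eqF// root_val_gt0.
have q20 : (2 \*o root_val) t != 0 by rewrite /= mulf_neq0.
have ? := is_deriveV q20.
apply: (@is_derive_eq _ _ _ (u' \* (fun t => ((2 \*o root_val) t)^-1))).
rewrite /root_acc /root_vel -(root_val_sqr tab') /GRing.scale/=; by field.
Qed.

End root.
End interval_calculus.

(** * Square roots of densities along a curve *)

Section derivative_measurability.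
Context {R : realType}.

(** A sequence of points of [[a, b]] other than [t] that tends to [t]; it moves
    towards an end point different from [t]. *)
Definition approx_seq (a b t : R) (n : nat) : R :=
  t + ((if t == a then b else a) - t) * n.+1%:R^-1.

Lemma approx_seq_in (a b t : R) n : a < b -> t \in `[a, b] ->
  approx_seq a b t n \in `[a, b].
Proof.
move=> ab; rewrite !in_itv/= => /andP[at_ tb]; rewrite /approx_seq.
have n0 : 0 < n.+1%:R^-1 :> R by rewrite invr_gt0.
have n1 : n.+1%:R^-1 <= 1 :> R by rewrite invf_le1// ler1n.
move: (n.+1%:R^-1) n0 n1 => z z0 z1.
by case: eqP => [ta|_]; apply/andP; split; nra.
Qed.

Lemma approx_seq_neq (a b t : R) n : a < b -> approx_seq a b t n != t.
Proof.
move=> ab; rewrite /approx_seq -subr_eq0 addrC addKr mulf_neq0//.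
by rewrite subr_eq0; have [->|ta] := eqVneq t a; [rewrite gt_eqF|rewrite eq_sym].
Qed.

Lemma approx_seq_cvg (a b t : R) : approx_seq a b t n @[n --> \oo] --> t.
Proof.
rewrite /approx_seq -[X in _ --> X]addr0; apply: cvgD; first exact: cvg_cst.
rewrite -[X in _ --> X](mulr0 ((if t == a then b else a) - t)).
by apply: cvgM; [exact: cvg_cst|exact: cvg_harmonic].
Qed.

(** The derivative is the limit of difference quotients along a fixed sequence
    of times, each of which is measurable in [x]. *)
Lemma measurable_derive_on d (T : measurableType d) (F : T -> R -> R) (a b t : R) :
  a < b -> t \in `[a, b] ->
  (forall s, s \in `[a, b] -> measurable_fun setT (F^~ s)) ->
  (forall x, derivable_on `[a, b] (F x)) ->
  measurable_fun setT (fun x => derive_on `[a, b] (F x) t).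
Proof.
move=> ab tab mF dF.
pose s := approx_seq a b t.
have stab n := approx_seq_in n ab tab.
apply: (@measurable_fun_cvg d T R setT (fun n x => (s n - t)^-1 * (F x (s n) - F x t))).
  move=> n; apply: measurable_funM; first exact: measurable_cst.
  by apply: measurable_funB; apply: mF.
move=> x _.
have c : s n @[n --> \oo] --> within `[a, b] (dnbhs t).
  move=> P HP.
  have HP' : \forall s \near t, s != t -> s \in `[a, b] -> P s by exact: HP.
  have H : \forall n \near \oo, s n != t -> s n \in `[a, b] -> P (s n).
    exact: (@approx_seq_cvg a b t _ HP').
  suff : \forall n \near \oo, P (s n) by [].
  apply: filterS H => n; apply; [exact: approx_seq_neq|exact: stab].
have := cvg_comp _ _ c (dF x t tab); apply.
Qed.

End derivative_measurability.

Section curve_roots.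
Context {R : realType} {M : ptopologicalType} (lam : probability (borel M) R).
Hypotheses (cM : compact [set: M]) (lam_full : full_support lam).
Variables (a b : R) (c : R -> probability (borel M) R).
Hypothesis (cc : is_curve lam a b c).

Lemma ae_impl (P Q : M -> Prop) : (forall x, P x -> Q x) ->
  {ae lam, forall x, P x} -> {ae lam, forall x, Q x}.
Proof. by move=> PQ; apply: (@filterS (borel M) (almost_everywhere lam)). Qed.

Lemma ae_conj (P Q : M -> Prop) : {ae lam, forall x, P x} ->
  {ae lam, forall x, Q x} -> {ae lam, forall x, P x /\ Q x}.
Proof.
by move=> aP aQ; apply: (@filterI (borel M) (almost_everywhere lam)).
Qed.

Local Notation u := (curve_dens lam c).

Let ab : a < b. Proof. by case: cc. Qed.

Lemma curve_density t : t \in `[a, b] -> is_density lam (c t) (fun x => u x t).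
Proof.
case: cc => _ cP _ _ tab; have /PplusP[f mf] := cP t tab.
suff -> : (fun x => u x t) = f by [].
by apply/funext => x; rewrite /curve_dens (RNd_density cM lam_full mf).
Qed.

Let u_gt0 x t : t \in `[a, b] -> 0 < u x t.
Proof. by move=> /curve_density[]. Qed.

Let uC2 x : C2_on `[a, b] (u x). Proof. by case: cc. Qed.

Definition croot_val (x : M) := root_val (u x).
Definition croot_vel (x : M) := root_vel a b (u x).
Definition croot_acc (x : M) := root_acc a b (u x).

Lemma continuous_croot_val t : t \in `[a, b] -> continuous (croot_val^~ t).
Proof. by move=> tab; apply: cont_sqrt; case: (curve_density tab). Qed.

Lemma croot_val_gt0 x t : t \in `[a, b] -> 0 < croot_val x t.
Proof. by move=> tab; apply: root_val_gt0 tab => s; exact: u_gt0. Qed.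

Lemma croot_val_sqr x t : t \in `[a, b] -> croot_val x t ^+ 2 = u x t.
Proof. by move=> tab; apply: root_val_sqr tab => s; exact: u_gt0. Qed.

Lemma ip_croot_val t : t \in `[a, b] -> ip lam (croot_val^~ t) (croot_val^~ t) = 1.
Proof.
move=> tab; rewrite -(density_int1 (curve_density tab)).
by apply: eq_Rintegral => x _; rewrite -expr2 croot_val_sqr.
Qed.

Lemma measurable_curve_derive1 t : t \in `[a, b] ->
  measurable_fun [set: borel M] (fun x => derive_on `[a, b] (u x) t).
Proof.
move=> tab; apply: measurable_derive_on => //.
- by move=> s sab; apply: continuous_borel; case: (curve_density sab).
- by move=> x; case: (uC2 x).
Qed.

Lemma measurable_curve_derive2 t : t \in `[a, b] ->
  measurable_fun [set: borel M]
    (fun x => derive_on `[a, b] (derive_on `[a, b] (u x)) t).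
Proof.
move=> tab; apply: (@measurable_derive_on R _ (borel M) (fun x => derive_on `[a, b] (u x))) => //.
- by move=> s sab; exact: measurable_curve_derive1.
- by move=> x; case: (uC2 x).
Qed.

Lemma measurable_croot_vel t : t \in `[a, b] ->
  measurable_fun [set: borel M] (croot_vel^~ t).
Proof.
move=> tab; rewrite /croot_vel /root_vel; apply: measurable_funM.
  exact: measurable_curve_derive1.
apply: continuous_borel; apply: contV.
  by move=> x; rewrite mulf_neq0// gt_eqF// -/(croot_val x t) croot_val_gt0.
by apply: contM; [exact: contC|exact: continuous_croot_val].
Qed.

(** The derivative of the density is measurable in [x], hence almost everywhere
    equal to the continuous density of the velocity, which the definition of a
    tangent vector provides. *)
Lemma curve_velocity t : t \in `[a, b] -> exists h : M -> R,
  [/\ continuous h, \int[lam]_x h x = 0,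
      {ae lam, forall x, derive_on `[a, b] (u x) t = h x} &
      velocity lam a b c t =m wmeas lam h].
Proof.
case: cc => _ _ _ cT tab; have [h [ch h0 vh]] := cT t tab.
exists h; split => //.
- by rewrite /Rintegral; have := h0; rewrite /wmeas => ->.
- by apply: wmeas_ae_eq => //; exact: measurable_curve_derive1.
Qed.

(** In square-root coordinates [q = sqrt f] one has [q' = f' / (2 q)].  Zero
    total mass of the velocity becomes orthogonality of [q] and [q'], and the
    Fisher norm becomes twice the L2 norm of [q']. *)
Lemma curve_root_velocity t : t \in `[a, b] -> exists g : M -> R,
  [/\ continuous g, ip lam (croot_val^~ t) g = 0,
      {ae lam, forall x, croot_vel x t = g x} &
      fisher (c t) (velocity lam a b c t) (velocity lam a b c t) = 4 * ip lam g g].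
Proof.
move=> tab; have [h [ch h0 aeh vh]] := curve_velocity tab.
have q0 x : croot_val x t != 0 by rewrite gt_eqF// croot_val_gt0.
have cg : continuous (fun x => h x / (2 * croot_val x t)).
  apply: contM => //; apply: contV; first by move=> x; rewrite mulf_neq0.
  by apply: contM; [exact: contC|exact: continuous_croot_val].
exists (fun x => h x / (2 * croot_val x t)); split => //.
- rewrite /ip (_ : \int[lam]_x _ = \int[lam]_x (2^-1 * h x)).
    by rewrite RintZ// h0 mulr0.
  by apply: eq_Rintegral => x _; have := q0 x => ?; field.
- by apply: ae_impl aeh => x E; rewrite /croot_vel /root_vel E.
- rewrite (fisher_eq cM lam_full (curve_density tab) ch vh ch vh).
  rewrite /ip -RintZ//; last exact: contM.
  apply: eq_Rintegral => x _; rewrite -croot_val_sqr//.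
  by have := q0 x => ?; field.
Qed.

(** The geodesic equation in square-root coordinates is
    [q'' = - (energy / 4) q], the equation of a great circle.  It holds only for
    almost every [x], and the exceptional set may depend on [t], because the
    equation is an identity between measures. *)
Lemma curve_root_acceleration t : t \in `[a, b] -> geodesic lam a b c ->
  {ae lam, forall x, croot_acc x t =
    - (fisher (c t) (velocity lam a b c t) (velocity lam a b c t) / 4) * croot_val x t}.
Proof.
move=> tab [_ /(_ t tab) geo].
have [h [ch h0 aeh vh]] := curve_velocity tab.
have q0 x : croot_val x t != 0 by rewrite gt_eqF// croot_val_gt0.
move: geo; set k := fisher _ _ _ => geo.
have mf := curve_density tab; have [cf f0 _] := mf.
have chf : continuous (fun x => h x / u x t).
  by apply: contM => //; apply: contV => // x; rewrite gt_eqF.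
have cv : continuous (fun x => - 2^-1 * (h x / u x t * (h x / u x t) - k)).
  apply: contM; first exact: contC.
  by apply: contB; [exact: contM|exact: contC].
have levi : levi_civita (c t) (velocity lam a b c t) (velocity lam a b c t) =m
    wmeas lam (fun x => - 2^-1 * (h x / u x t * (h x / u x t) - k) * u x t).
  move=> A mA; rewrite /levi_civita (RNd_eq cM lam_full mf ch vh) -/k.
  by rewrite (wmeas_density cM mf cv).
set w := fun x => - 2^-1 * (h x / u x t * (h x / u x t) - k) * u x t.
have cw : continuous w by exact: contM.
have acc : acceleration lam a b c t =m wmeas lam (fun x => -1 * w x).
  move=> A mA; rewrite wmeasZ// EFinN mulN1e.
  have := geo A mA; rewrite levi// -/w.
  have := wmeas_fin lam cM cw mA; case: (wmeas lam w A) => // r _.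
  by case: (acceleration _ _ _ _ _ _) => //= s [] sr; congr EFin; lra.
have aeacc : {ae lam, forall x,
    derive_on `[a, b] (derive_on `[a, b] (u x)) t = -1 * w x}.
  apply: wmeas_ae_eq => //; first exact: measurable_curve_derive2.
  by apply: contM => //; exact: contC.
apply: ae_impl (ae_conj aeh aeacc) => x [E1 E2].
rewrite /croot_acc /root_acc E1 E2 /w -/(croot_val x t) -croot_val_sqr//.
by have := q0 x => ?; field.
Qed.

End curve_roots.

(** * Angles between unit vectors *)

Section angles.
Context {R : realType} {M : ptopologicalType} (lam : probability (borel M) R).
Hypothesis cM : compact [set: M].
Implicit Types p q r : M -> R.

Definition unit_fun p := continuous p /\ ip lam p p = 1.

Definition angle p q : R := acos (ip lam p q).

Lemma ip_unit_bound p q : unit_fun p -> unit_fun q -> -1 <= ip lam p q <= 1.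
Proof.
move=> [cp p1] [cq q1]; rewrite -ler_norml -(@ler_pXn2r _ 2) ?nnegrE//.
by rewrite expr1n real_normK ?num_real// (le_trans (ip_cauchy_schwarz lam cM cp cq))// p1 q1 mulr1.
Qed.

Lemma le_acos (x y : R) : -1 <= x <= 1 -> 0 <= y <= pi -> cos y <= x ->
  acos x <= y.
Proof.
move=> x1 y1 cyx; rewrite leNgt; apply/negP => yx.
have : cos (acos x) < cos y.
  by rewrite ltr_cos// in_itv/= acos_ge0// acos_lepi.
by rewrite acosK// ltNge cyx.
Qed.

(** The components of [p] and [r] orthogonal to [q] have norms
    [sin (angle p q)] and [sin (angle q r)]; the Cauchy-Schwarz inequality for
    them says that [(p, r)] is at least the cosine of the sum of the angles. *)
Lemma angle_triangle p q r : unit_fun p -> unit_fun q -> unit_fun r ->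
  angle p r <= angle p q + angle q r.
Proof.
move=> up uq ur; have [cp p1] := up; have [cq q1] := uq; have [cr r1] := ur.
have xb := ip_unit_bound up uq; have yb := ip_unit_bound uq ur.
have zb := ip_unit_bound up ur.
rewrite /angle; set x := ip lam p q in xb *; set y := ip lam q r in yb *.
set z := ip lam p r in zb *.
have [ge|lt] := leP pi (acos x + acos y).
  by rewrite (le_trans _ ge)// acos_lepi.
apply: le_acos => //; first by rewrite addr_ge0 ?acos_ge0 ?(ltW lt).
rewrite cosD !acosK// !sin_acos//.
pose p' t := 1 * p t + (- x) * q t; pose r' t := 1 * r t + (- y) * q t.
have c' (f : M -> R) (k : R) : continuous f -> continuous (fun t => 1 * f t + k * q t).
  by move=> cf; apply: contD; apply: contM => //; exact: contC.
have E1 : ip lam p' p' = 1 - x ^+ 2 by rewrite ip_sqr// p1 q1 -/x; ring.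
have E2 : ip lam r' r' = 1 - y ^+ 2.
  by rewrite ip_sqr// r1 q1 (ipC _ r q) -/y; ring.
have E3 : ip lam p' r' = z - x * y.
  rewrite ip_lin//; last exact: c'.
  rewrite (ipC _ p) (ipC _ q) !ip_lin// q1 (ipC _ r p) (ipC _ r q) (ipC _ q p).
  by rewrite -/x -/y -/z; ring.
have := ip_cauchy_schwarz lam cM (c' p (- x) cp) (c' r (- y) cr).
rewrite -/p' -/r' E1 E2 E3 => CS.
rewrite -sqrtrM; last by rewrite -E1 ip_ge0.
have : `|z - x * y| <= Num.sqrt ((1 - x ^+ 2) * (1 - y ^+ 2)).
  by rewrite -sqrtr_sqr ler_wsqrtr.
rewrite ler_norml => /andP[+ _].
by rewrite lerBrDr addrC.
Qed.

Lemma ip_chord p q : unit_fun p -> unit_fun q ->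
  ip lam (fun x => q x - p x) (fun x => q x - p x) = 2 - 2 * ip lam p q.
Proof.
move=> [cp p1] [cq q1].
transitivity (ip lam (fun x => 1 * q x + (-1) * p x) (fun x => 1 * q x + (-1) * p x)).
  by apply: eq_Rintegral => x _ /=; ring.
by rewrite ip_sqr// p1 q1 (ipC _ q); ring.
Qed.

Lemma sin_ge_lin (e : R) : 0 < e -> exists2 d : R, 0 < d &
  forall y, 0 <= y < d -> y <= (1 + e) * sin y.
Proof.
move=> e0; have e1 : 0 < 1 + e by rewrite addr_gt0.
have : \forall c \near (0 : R), (1 + e)^-1 < cos c.
  have c0 : cos c @[c --> (0 : R)] --> cos (0 : R) by exact: continuous_cos.
  by apply: (cvgr_gt _ c0); rewrite cos0 invf_lt1// ltrDl.
move=> [d/= d0 dc]; exists d => // y /andP[y0 yd].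
have [c] := @MVT_segment R sin cos 0 y y0 (fun x _ => is_derive_sin x)
  (continuous_subspaceT (@continuous_sin R)).
rewrite in_itv/= => /andP[c0 cy]; rewrite sin0 !subr0 => ->.
have cc : (1 + e)^-1 < cos c.
  by apply: dc; rewrite /= sub0r normrN ger0_norm// (le_lt_trans cy).
by rewrite mulrA ler_peMl// -ler_pdivrMl// mulr1 ltW.
Qed.

(** For unit vectors at angle [th] the chord is [2 sin (th / 2)], and
    [sin y / y] tends to 1 at 0. *)
Lemma angle_le_chord (e : R) : 0 < e -> exists2 d : R, 0 < d &
  forall p q L, unit_fun p -> unit_fun q -> 0 <= L < d ->
    ip lam (fun x => q x - p x) (fun x => q x - p x) <= L ^+ 2 ->
    angle p q <= (1 + e) * L.
Proof.
move=> e0; have e1 : 0 < 1 + e by rewrite addr_gt0.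
have [d d0 dsin] := sin_ge_lin e0.
have pi0 := pi_gt0 R.
exists (2 * Num.min d pi / (1 + e)).
  by rewrite divr_gt0// mulr_gt0// lt_min d0.
move=> p q L up uq /andP[L0]; rewrite ltr_pdivlMr// => Ld.
rewrite ip_chord// => chord; rewrite leNgt; apply/negP.
rewrite /angle; have xb := ip_unit_bound up uq.
have : cos (acos (ip lam p q)) = ip lam p q by apply: acosK; rewrite in_itv.
have := acos_ge0 xb; have := acos_lepi xb.
move: chord; set x := ip lam p q; set th := acos x => chord thpi th0 thx Lth.
have y0 : 0 <= (1 + e) * L / 2 by rewrite divr_ge0// mulr_ge0// ltW.
have yd : (1 + e) * L / 2 < d /\ (1 + e) * L / 2 < pi.
  have := Ld; have : Num.min d pi <= d by rewrite ge_min lexx.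
  have : Num.min d pi <= pi by rewrite ge_min lexx orbT.
  by split; nra.
have sinth : sin (th / 2) ^+ 2 <= (L / 2) ^+ 2.
  rewrite sin2cos2; have : cos th = 2 * cos (th / 2) ^+ 2 - 1.
    by rewrite {1}(splitr th) cosD -!expr2 sin2cos2; ring.
  rewrite thx; nra.
have s0 : 0 <= sin (th / 2).
  apply: sin_ge0_pi; apply/andP; split; lra.
have sinL : sin (th / 2) <= L / 2.
  by rewrite -(@ler_pXn2r _ 2) ?nnegrE ?divr_ge0.
have : sin ((1 + e) * L / 2) < sin (th / 2).
  have yth : (1 + e) * L / 2 < th / 2 by lra.
  rewrite ltr_sin//; rewrite in_itv/=; apply/andP; split; lra.
have := dsin ((1 + e) * L / 2); rewrite y0 yd.1 => /(_ isT).
move: (sin _) (sin (th / 2)) s0 sinL => s s'; nra.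
Qed.

End angles.

(** * Joint measurability and chains of short intervals *)

Section caratheodory.
Context {R : realType} d (T : measurableType d).

Definition grid_floor (n : nat) (t : R) : R := (Num.floor (n.+1%:R * t))%:~R / n.+1%:R.

Lemma grid_floor_cvg (t : R) : grid_floor n t @[n --> \oo] --> t.
Proof.
apply: (@squeeze_cvgr _ _ _ _ (fun n => t - n.+1%:R^-1) (fun=> t)).
- apply: nearW => n; have n0 : 0 < n.+1%:R :> R by [].
  rewrite /grid_floor; apply/andP; split; last first.
    by rewrite ler_pdivrMr// mulrC ge_floor.
  rewrite ler_pdivlMr// mulrBl mulVf ?gt_eqF// mulrC lerBlDr.
  by have := floorD1_gt (n.+1%:R * t); rewrite intrD => /ltW.
- rewrite -[X in _ --> X]subr0; apply: cvgB; first exact: cvg_cst.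
  exact: cvg_harmonic.
- exact: cvg_cst.
Qed.

(** Continuity in [t] makes [G] the limit of its values at the grid points just
    below [t], and these approximations are constant in [t] on each of countably
    many intervals. *)
Lemma measurable_caratheodory (G : T * R -> R) :
  (forall t, measurable_fun setT (fun x => G (x, t))) ->
  (forall x, continuous (fun t => G (x, t))) ->
  measurable_fun [set: T * R] G.
Proof.
move=> mG cG.
apply: (@measurable_fun_cvg _ _ R setT (fun n p => G (p.1, grid_floor n p.2))).
- move=> n _ Y mY; rewrite setTI.
  (* Preimages under the [n]th approximation are countable unions of
     rectangles indexed by the grid points. *)
  pose B (k : int) := `[k%:~R / n.+1%:R, (k + 1)%:~R / n.+1%:R[%classic : set R.
  pose A (k : int) := (fun x => G (x, k%:~R / n.+1%:R)) @^-1` Y.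
  pose F (m : nat) := if unpickle m is Some k then A k `*` B k else set0.
  rewrite (_ : _ @^-1` _ = \bigcup_m F m).
    apply: bigcupT_measurable => m; rewrite /F; case: (unpickle m) => // k.
    apply: measurableX; last exact: measurable_itv.
    by have := mG (k%:~R / n.+1%:R) measurableT Y mY; rewrite setTI.
  have n0 : 0 < n.+1%:R :> R by [].
  apply/seteqP; split => [[x t]/= Yxt|[x t] [m _]].
    exists (pickle (Num.floor (n.+1%:R * t))); first exact: I.
    rewrite /F pickleK; split => //=.
    rewrite /B/= in_itv/= ler_pdivrMr// ltr_pdivlMr// mulrC ge_floor/=.
    exact: floorD1_gt.
  rewrite /F; case: (unpickle m) => // k [/=].
  rewrite /A/= /B/= in_itv/= ler_pdivrMr// ltr_pdivlMr// => Yk kt.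
  have /= E := floor_def kt; rewrite /grid_floor /= [n.+1%:R * t]mulrC E; exact: Yk.
- move=> [x t] _ /=.
  have cxt : G (x, s) @[s --> (t : R)] --> G (x, t) by apply: cG.
  have := cvg_comp _ (fun s => G (x, s)) (@grid_floor_cvg t) cxt; exact.
Qed.

End caratheodory.

Section partition.
Context {R : realType}.

(** Subdivide [[a, b]] into equal intervals shorter than [d]. *)
Lemma interval_chaining (P : R -> R -> Prop) (a b d : R) : a <= b -> 0 < d ->
  (forall s t, a <= s -> s <= t -> t <= b -> t - s < d -> P s t) ->
  (forall s t, a <= s -> s <= t -> t <= b -> P a s -> P s t -> P a t) ->
  P a b.
Proof.
move=> ab d0 small trans.
pose N := (Num.truncn ((b - a) / d)).+1.
have N0 : 0 < N%:R :> R by [].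
have Nd : (b - a) / N%:R < d.
  rewrite ltr_pdivrMr// mulrC -ltr_pdivrMr//.
  by rewrite truncnS_gt.
pose h := (b - a) / N%:R.
have h0 : 0 <= h by rewrite divr_ge0 ?subr_ge0.
have hb k : (k <= N)%N -> a + k%:R * h <= b.
  move=> kN; rewrite -lerBrDl /h mulrCA ler_piMr ?subr_ge0//.
  by rewrite ler_pdivrMr// mul1r ler_nat.
have step k : (k <= N)%N -> P a (a + k%:R * h).
  elim: k => [_|k IH kN].
    by rewrite mul0r addr0; apply: small; rewrite ?lexx// subrr.
  have E : a + k.+1%:R * h = a + k%:R * h + h by rewrite -natr1; ring.
  have ak : a <= a + k%:R * h by rewrite lerDl mulr_ge0.
  apply: (trans (a + k%:R * h)) => //.
  - by rewrite E lerDl.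
  - exact: hb.
  - by apply: IH; exact: ltnW.
  - apply: small => //; first by rewrite E lerDl.
      exact: hb.
    by rewrite E addrC addKr.
have := step N (leqnn _); rewrite /h mulrC divfK ?gt_eqF//.
by rewrite addrC subrK.
Qed.

End partition.

(** * Lengths are bounded below by angles *)

Section length_lower_bound.
Context {R : realType} {M : ptopologicalType} (lam : probability (borel M) R).
Hypotheses (cM : compact [set: M]) (lam_full : full_support lam).
Variables (a b : R) (c : R -> probability (borel M) R).
Hypothesis (cc : is_curve lam a b c).
Local Notation leb := (@lebesgue_measure R).

Let ab : a < b. Proof. by case: cc. Qed.

Definition speed t : R := fisher_norm (c t) (velocity lam a b c t).
Local Notation q := (croot_val lam c).
Local Notation v := (croot_vel lam a b c).

Lemma speed_ge0 t : 0 <= speed t. Proof. exact: sqrtr_ge0. Qed.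

Lemma integral_root_vel_sqr t : t \in `[a, b] ->
  (\int[lam]_x (v x t ^+ 2)%:E)%E = ((speed t / 2) ^+ 2)%:E.
Proof.
move=> tab; have [g [cg _ aeg fg]] := curve_root_velocity cM lam_full cc tab.
have -> : (speed t / 2) ^+ 2 = ip lam g g.
  have g0 : 0 <= ip lam g g by exact: ip_ge0.
  rewrite expr_div_n /speed /fisher_norm sqr_sqrtr fg; first by field.
  by rewrite mulr_ge0.
rewrite /ip EFin_Rint//; last exact: contM.
apply: ge0_ae_eq_integral => //.
- apply/measurable_EFinP; apply: measurable_funX.
  exact: (measurable_croot_vel cM lam_full cc).
- by apply/measurable_EFinP; apply: (@continuous_borel R M); exact: contM.
- by move=> x _; rewrite lee_fin sqr_ge0.
- by move=> x _; rewrite lee_fin -expr2 sqr_ge0.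
- by apply: ae_impl aeg => x -> _; rewrite expr2.
Qed.

(** The velocity of the square root, extended to all times so as to be defined
    on a product of measurable spaces. *)
Definition vclamp (p : borel M * R) : R := v p.1 (clamp a b p.2).

Lemma measurable_vclamp : measurable_fun [set: borel M * R] vclamp.
Proof.
apply: measurable_caratheodory => [t|x].
  rewrite /vclamp/=.
  exact: (measurable_croot_vel cM lam_full cc (clamp_in t (ltW ab))).
rewrite /vclamp/=.
apply: (@cont_clamp _ a b (v x) (ltW ab)); apply: cont_root_vel => //.
  by case: cc.
by move=> t tab; have [_ + _] := curve_density cM lam_full cc tab; apply.
Qed.

(** The speed at [t] is, up to a factor and a square root, an integral in [x] of
    a jointly measurable function; Tonelli's theorem gives measurability. *)
Lemma measurable_speed : measurable_fun `[a, b] speed.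
Proof.
pose h t := fine (\int[lam]_x (vclamp (x, t) ^+ 2)%:E)%E.
have hE t : t \in `[a, b] -> h t = (speed t / 2) ^+ 2.
  by move=> tab; rewrite /h /vclamp /= clamp_id// integral_root_vel_sqr.
have mh : measurable_fun setT h.
  apply: measurableT_comp => //.
  apply: (measurable_fun_fubini_tonelli_G (fun p => (vclamp p ^+ 2)%:E)).
    by apply/measurable_EFinP; apply: measurable_funX; exact: measurable_vclamp.
  by move=> p; rewrite lee_fin sqr_ge0.
apply: (@eq_measurable_fun _ _ _ _ _ (fun t => 2 * Num.sqrt (h t))).
  move=> t; rewrite inE/= => tab; rewrite hE// sqrtr_sqr ger0_norm.
    by rewrite mulrC divfK.
  by rewrite divr_ge0// speed_ge0.
apply: measurable_funTS; apply: measurable_funM => //.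
apply: measurableT_comp => //.
exact: continuous_measurable_fun (@sqrt_continuous R).
Qed.

Lemma root_increment x s t : a <= s -> s <= t -> t <= b ->
  ((`|q x t - q x s|)%:E <= \int[leb]_(r in `[s, t]) (`|v x r|)%:E)%E.
Proof.
move=> as_ st tb.
have u0 r : r \in `[a, b] -> 0 < curve_dens lam c x r.
  by move=> rab; have [_ + _] := curve_density cM lam_full cc rab; apply.
have uC2 : C2_on `[a, b] (curve_dens lam c x) by case: cc.
have cq : cont_itv s t (q x) by apply: (cont_itv_sub as_ tb); exact: cont_root_val.
have cv : cont_itv s t (v x) by apply: (cont_itv_sub as_ tb); exact: cont_root_vel.
have mv : measurable_fun `[s, t] (v x).
  by apply: subspace_continuous_measurable_fun => //; exact/cont_itvP.
have := FTC_itv st cq cv.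
have dq r : r \in `]s, t[ -> is_derive r 1 (q x) (v x r).
  move=> rst; apply: is_derive_root_val => //.
  by move: rst; apply: subset_itv; rewrite bnd_simp.
move=> /(_ dq) E; rewrite -[(`|_|)%:E]/(`|(q x t - q x s)%:E|)%E -E.
apply: (@le_abse_integral _ _ _ leb `[s, t]%classic (fun r => (v x r)%:E)) => //.
exact/measurable_EFinP.
Qed.

Let dist2 s t := ip lam (fun x => q x t - q x s) (fun x => q x t - q x s).

(** The function of [(x, r)] whose two iterated integrals are compared in the
    bound of a chord by a length. *)
Let tonelli_fun s t (p : borel M * R) : \bar R :=
  (`|q p.1 t - q p.1 s| * `|vclamp p| * \1_(`[s, t]%classic) p.2)%:E.

Let tonelli_fun_ge0 s t p : (0 <= tonelli_fun s t p)%E.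
Proof. by rewrite lee_fin !mulr_ge0. Qed.

Let continuous_increment s t : s \in `[a, b] -> t \in `[a, b] ->
  continuous (fun x => q x t - q x s).
Proof.
by move=> sab tab; apply: contB; apply: (continuous_croot_val cM lam_full cc).
Qed.

Let measurable_tonelli_fun s t : s \in `[a, b] -> t \in `[a, b] ->
  measurable_fun [set: borel M * R] (tonelli_fun s t).
Proof.
move=> sab tab; apply/measurable_EFinP; apply: measurable_funM.
  apply: measurable_funM.
    have mh : measurable_fun [set: borel M] (fun x => q x t - q x s).
      by apply: (@continuous_borel R M); exact: continuous_increment.
    have mn : measurable_fun [set: R] (@Num.norm R R) by [].
    exact: (measurableT_comp mn (measurableT_comp mh measurable_fst)).
  have mn : measurable_fun [set: R] (@Num.norm R R) by [].
  exact: (measurableT_comp mn measurable_vclamp).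
have mi : measurable_fun [set: R] (\1_(`[s, t]%classic) : R -> R) by [].
exact: (measurableT_comp mi measurable_snd).
Qed.

Let ip_root_vel s t r : s \in `[a, b] -> t \in `[a, b] -> r \in `[a, b] ->
  (\int[lam]_x (`|q x t - q x s| * `|v x r|)%:E <=
     (Num.sqrt (dist2 s t) * (speed r / 2))%:E)%E.
Proof.
move=> sab tab rab; have [g [cg _ aeg fg]] := curve_root_velocity cM lam_full cc rab.
have cd := continuous_increment sab tab.
have cnorm (f : M -> R) : continuous f -> continuous (fun x => `|f x|).
  by move=> cf x; apply: (continuous_comp (cf x)); exact: norm_continuous.
rewrite (@ge0_ae_eq_integral _ _ _ lam setT _ (fun x => (`|q x t - q x s| * `|g x|)%:E)) //.
- rewrite -EFin_Rint//; last by apply: contM; exact: cnorm.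
  rewrite lee_fin.
  have -> : speed r / 2 = Num.sqrt (ip lam g g).
    have -> : ip lam g g = (speed r / 2) ^+ 2.
      have g0 : 0 <= ip lam g g by exact: ip_ge0.
      rewrite expr_div_n /speed /fisher_norm sqr_sqrtr fg; first by field.
      by rewrite mulr_ge0.
    by rewrite sqrtr_sqr ger0_norm// divr_ge0// speed_ge0.
  rewrite -sqrtrM; last exact: ip_ge0.
  have := ip_cauchy_schwarz lam cM (cnorm _ cd) (cnorm _ cg).
  have E (f : M -> R) : ip lam (fun x => `|f x|) (fun x => `|f x|) = ip lam f f.
    by apply: eq_Rintegral => x _; rewrite -normrM -expr2 ger0_norm ?sqr_ge0// expr2.
  rewrite !E -/(dist2 s t) => CS.
  by rewrite (le_trans (ler_norm _))// -sqrtr_sqr ler_wsqrtr.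
- apply/measurable_EFinP; apply: measurable_funM.
    by apply: (@continuous_borel R M); exact: cnorm.
  apply: (@measurableT_comp _ _ _ _ _ _ (@Num.norm R R)) => //.
  exact: (measurable_croot_vel cM lam_full cc).
- apply/measurable_EFinP; apply: (@continuous_borel R M).
  by apply: contM; exact: cnorm.
- by apply: (@ae_impl _ _ lam (fun x => v x r = g x)) => [x -> _|]; [by []|exact: aeg].
Qed.

(** Test the increment [q_t - q_s] against itself.  At each [x] it is at most
    the integral of [|q'|] over [[s, t]]; Tonelli's theorem exchanges the
    integrals and the Cauchy-Schwarz inequality bounds the inner one by
    [|q_t - q_s| * speed / 2].  Nothing is differentiated under the integral
    sign, so no uniformity in [x] of the time regularity is required. *)
Lemma chord_le_length s t : a <= s -> s <= t -> t <= b ->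
  ((dist2 s t)%:E <=
    (Num.sqrt (dist2 s t) / 2)%:E * \int[leb]_(r in `[s, t]) (speed r)%:E)%E.
Proof.
move=> as_ st tb.
have sab : s \in `[a, b] by rewrite in_itv/= as_ (le_trans st).
have tab : t \in `[a, b] by rewrite in_itv/= tb (le_trans as_).
have sub : `[s, t] `<=` `[a, b] by apply: subset_itv; rewrite bnd_simp.
have cd := continuous_increment sab tab.
have E1 : ((dist2 s t)%:E <= \int[lam]_x \int[leb]_r tonelli_fun s t (x, r))%E.
  rewrite /dist2 /ip EFin_Rint//; last exact: contM.
  apply: ge0_le_integralT => x; first by rewrite lee_fin -expr2 sqr_ge0.
  have -> : (\int[leb]_r tonelli_fun s t (x, r) =
     \int[leb]_(r in `[s, t]) (`|q x t - q x s|%:E * `|v x r|%:E))%E.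
    rewrite [RHS]integral_mkcond; apply: eq_integral => r _.
    rewrite /tonelli_fun /= /patch indicE.
    have [rst|] := boolP (r \in `[s, t]%classic); last by rewrite mulr0.
    rewrite mulr1 /vclamp/= clamp_id//.
    by move: rst; rewrite inE => /sub.
  rewrite ge0_integralZl//; last first.
    apply/measurable_EFinP.
    apply: (@measurableT_comp _ _ _ _ _ _ (@Num.norm R R)) => //.
    apply: subspace_continuous_measurable_fun => //; apply/cont_itvP.
    apply: (cont_itv_sub as_ tb); apply: cont_root_vel => //; first by case: cc.
    by move=> r rab; have [_ + _] := curve_density cM lam_full cc rab; apply.
  apply: le_trans (lee_wpmul2l _ (root_increment x as_ st tb)) => //.
  by rewrite -EFinM -normrM -expr2 lee_fin ler_norm.
apply: (le_trans E1).
have swap := @fubini_tonelli _ _ _ _ R lam leb (tonelli_fun s t)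
  (measurable_tonelli_fun sab tab) (tonelli_fun_ge0 s t).
rewrite swap.
have E2 : (\int[leb]_r \int[lam]_x tonelli_fun s t (x, r) <=
   \int[leb]_(r in `[s, t]) ((Num.sqrt (dist2 s t) / 2)%:E * (speed r)%:E))%E.
  rewrite [leRHS]integral_mkcond; apply: ge0_le_integralT => r.
    exact: integral_ge0.
  rewrite /patch; have [rst|rst] := boolP (r \in `[s, t]%classic).
    have rab : r \in `[a, b] by move: rst; rewrite inE => /sub.
    under eq_integral => x _.
      rewrite /tonelli_fun/= indicE rst mulr1 /vclamp/= clamp_id//; over.
    by rewrite (le_trans (ip_root_vel sab tab rab))// -EFinM lee_fin mulrA mulrAC.
  rewrite integral0_eq// => x _.
  by rewrite /tonelli_fun/= indicE (negbTE rst) mulr0.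
apply: (le_trans E2); rewrite ge0_integralZl//.
- by apply/measurable_EFinP; exact: measurable_funS measurable_speed.
- by move=> r _; rewrite lee_fin speed_ge0.
Qed.

(** When the length is finite, absolute continuity of the integral makes the
    arcs, and hence the chords, over short time intervals uniformly small; there
    the angle is at most [1 + e'] times the chord.  The triangle inequality for
    angles and the additivity of length extend the bound to [[a, b]]. *)
Lemma angle_le_length :
  ((2 * angle lam (q^~ a) (q^~ b))%:E <= curve_length lam a b c)%E.
Proof.
rewrite /curve_length; set I := (X in (_ <= X)%E).
have mS : measurable_fun `[a, b] (fun r => (speed r)%:E).
  by apply/measurable_EFinP; exact: measurable_speed.
have [Ioo|] := ltP I +oo%E; last by rewrite leye_eq => /eqP ->; rewrite leey.
have intS : leb.-integrable `[a, b] (EFin \o speed).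
  apply/integrableP; split => //.
  by under eq_integral => x _ do rewrite /= ger0_norm ?speed_ge0//.
have intS_sub s t : a <= s -> t <= b -> leb.-integrable `[s, t] (EFin \o speed).
  move=> as_ tb; apply: (integrableS _ _ _ intS) => //.
  by apply: subset_itv; rewrite bnd_simp.
pose L s t := \int[leb]_(r in `[s, t]) speed r.
have LE s t : a <= s -> t <= b ->
    (L s t)%:E = (\int[leb]_(r in `[s, t]) (speed r)%:E)%E.
  by move=> as_ tb; rewrite /L fineK//; apply: integrable_fin_num => //; exact: intS_sub.
have L0 s t : 0 <= L s t by apply: Rintegral_ge0 => r _; exact: speed_ge0.
have LD s t : a <= s -> s <= t -> t <= b -> L a t = L a s + L s t.
  move=> as_ st tb; have ia := intS_sub a t (lexx _) tb.
  have := @Rintegral_itvB R speed (BLeft a) (BRight t) s ia.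
  rewrite !bnd_simp => /(_ as_ st); rewrite Rintegral_itv_obnd_cbnd.
    by rewrite -/(L a t) -/(L a s) -/(L s t) => <-; rewrite addrC subrK.
  apply: (integrableS _ _ _ ia) => //.
  by apply: subset_itv; rewrite bnd_simp.
have chord s t : a <= s -> s <= t -> t <= b -> dist2 s t <= (L s t / 2) ^+ 2.
  move=> as_ st tb; have := chord_le_length as_ st tb.
  rewrite -LE// -EFinM lee_fin.
  have d0 : 0 <= dist2 s t by exact: ip_ge0.
  rewrite -{1}(sqr_sqrtr d0) -{3}(sqr_sqrtr d0).
  have := sqrtr_ge0 (dist2 s t); have := L0 s t.
  by move: (Num.sqrt _) (L s t) => n l; nra.
have uq t : t \in `[a, b] -> unit_fun lam (q^~ t).
  move=> tab; split; first exact: (continuous_croot_val cM lam_full cc).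
  exact: (ip_croot_val cM lam_full cc).
rewrite -[I]LE// lee_fin; apply/ler_addgt0Pr => e e0.
(* The relative error [e'] is chosen to cost at most [e] in total. *)
have [e' e'0 e'e] : exists2 e', 0 < e' & e' * L a b <= e.
  exists (e / (L a b + 1)); first by rewrite divr_gt0// ltr_wpDl.
  by rewrite mulrAC ler_pdivrMr ?ltr_wpDl// ler_wpM2l ?(ltW e0)// lerDl.
apply: (@le_trans _ _ ((1 + e') * L a b)); last first.
  by rewrite mulrDl mul1r lerD2l.
have [d d0 dang] := angle_le_chord lam cM e'0.
have [d' [d'0 dint]] : exists d', 0 < d' /\ forall A, measurable A ->
    (leb A < d'%:E)%E -> \int[leb]_(x in A) `|(speed \_ `[a, b]) x| < d.
  apply: integral_normr_continuous => //.
  by rewrite -restrict_EFin; apply/integrable_restrict => //; rewrite setTI.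
have small s t : a <= s -> s <= t -> t <= b -> t - s < d' -> L s t < d.
  move=> as_ st tb std.
  have : (leb `[s, t]%classic < d'%:E)%E.
    rewrite lebesgue_measure_itv/=; case: ifP => _; rewrite -?EFinB lte_fin//.
  move=> /(dint _ (measurable_itv _)); apply: le_lt_trans.
  rewrite le_eqVlt; apply/orP; left; apply/eqP.
  apply: eq_Rintegral => r; rewrite inE/= => rst.
  have rab : r \in `[a, b] by move: rst; apply: subset_itv; rewrite bnd_simp.
  by rewrite /patch mem_set// ger0_norm// speed_ge0.
pose P s t := 2 * angle lam (q^~ s) (q^~ t) <= (1 + e') * L s t.
apply: (@interval_chaining _ P a b d' (ltW ab) d'0).
- move=> s t as_ st tb std; rewrite /P.
  have sab : s \in `[a, b] by rewrite in_itv/= as_ (le_trans st).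
  have tab : t \in `[a, b] by rewrite in_itv/= tb (le_trans as_).
  have Ld : 0 <= L s t / 2 < d.
    have := small s t as_ st tb std; have := L0 s t.
    by move=> ? ?; apply/andP; split; lra.
  have := dang _ _ _ (uq s sab) (uq t tab) Ld (chord s t as_ st tb).
  lra.
- move=> s t as_ st tb Pas Pst; rewrite /P (LD s t)//.
  have sab : s \in `[a, b] by rewrite in_itv/= as_ (le_trans st).
  have tab : t \in `[a, b] by rewrite in_itv/= tb (le_trans as_).
  have aab : a \in `[a, b] by rewrite in_itv/= lexx ltW.
  rewrite mulrDr (le_trans _ (lerD Pas Pst))// -mulrDr ler_pM2l//.
  exact: (angle_triangle cM (uq a aab) (uq s sab) (uq t tab)).
Qed.

End length_lower_bound.

Section distance_lower_bound.
Context {R : realType} {M : ptopologicalType} (lam : probability (borel M) R).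
Hypotheses (cM : compact [set: M]) (lam_full : full_support lam).
Implicit Types m : probability (borel M) R.

(** By compactness [1 / h] is bounded, so [h] is bounded away from zero. *)
Lemma Rint_gt0 (h : M -> R) : continuous h -> (forall x, 0 < h x) ->
  0 < \int[lam]_x h x.
Proof.
move=> ch h0.
have cV : continuous (fun x => (h x)^-1).
  by apply: contV => // x; rewrite gt_eqF.
have [K K0 hK] := compact_bounded_continuous cM cV.
apply: (@lt_le_trans _ _ K^-1); first by rewrite invr_gt0.
rewrite -(Rint_cst lam K^-1); apply: le_Rintegral => //.
- by apply: continuous_integrable => //; exact: contC.
- exact: continuous_integrable.
- move=> x _; rewrite invf_ple ?posrE//.
  by have := hK x; rewrite ger0_norm// invr_ge0 ltW.
Qed.

Definition root_density m : M -> R := fun x => Num.sqrt (RNd m lam x).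

Lemma root_densityE m f : is_density lam m f ->
  root_density m = fun x => Num.sqrt (f x).
Proof. by move=> mf; rewrite /root_density (RNd_density cM lam_full mf). Qed.

Lemma eqm_root_density m m' : Pplus lam m -> m =m m' ->
  root_density m = root_density m'.
Proof.
move=> /PplusP[f mf] mm'; rewrite (root_densityE mf) (@root_densityE _ f)//.
by case: mf => cf f0 mf; split => // A mA; rewrite -mm'// mf.
Qed.

Lemma root_density_gt0 m x : Pplus lam m -> 0 < root_density m x.
Proof.
by move=> /PplusP[f mf]; rewrite (root_densityE mf) sqrtr_gt0; case: mf.
Qed.

Lemma unit_root_density m : Pplus lam m -> unit_fun lam (root_density m).
Proof.
move=> /PplusP[f mf]; rewrite (root_densityE mf); have [cf f0 _] := mf.
split; first exact: cont_sqrt.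
rewrite -(density_int1 mf); apply: eq_Rintegral => x _.
by rewrite -expr2 sqr_sqrtr// ltW.
Qed.

Lemma ip_root_density_gt0 m m' : Pplus lam m -> Pplus lam m' ->
  0 < ip lam (root_density m) (root_density m').
Proof.
move=> Pm Pm'; have [cu _] := unit_root_density Pm.
have [cu' _] := unit_root_density Pm'.
by apply: Rint_gt0 => [|x]; [exact: contM|rewrite mulr_gt0// root_density_gt0].
Qed.

Lemma RNd_ratio m m' : Pplus lam m -> Pplus lam m' ->
  RNd m' m = fun x => (root_density m' x / root_density m x) ^+ 2.
Proof.
move=> /PplusP[f mf] /PplusP[f' mf'].
have [cf f0 _] := mf; have [cf' f'0 mE'] := mf'.
rewrite (RNd_eq cM lam_full mf cf' mE') (root_densityE mf) (root_densityE mf').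
by apply/funext => x; rewrite expr_div_n !sqr_sqrtr// ltW.
Qed.

Lemma sqrt_RNd_ratio m m' : Pplus lam m -> Pplus lam m' ->
  (fun x => Num.sqrt (RNd m' m x)) = fun x => root_density m' x / root_density m x.
Proof.
move=> Pm Pm'; rewrite RNd_ratio//; apply/funext => x.
by rewrite sqrtr_sqr ger0_norm// divr_ge0// ltW// root_density_gt0.
Qed.

Lemma is_density_root m : Pplus lam m ->
  is_density lam m (fun x => root_density m x ^+ 2).
Proof.
move=> /PplusP[f mf]; have [cf f0 mE] := mf.
rewrite (root_densityE mf) (_ : (fun x => _) = f)//.
by apply/funext => x; rewrite sqr_sqrtr// ltW.
Qed.

Lemma Rint_sqrt_RNd m m' : Pplus lam m -> Pplus lam m' ->
  \int[m]_x Num.sqrt (RNd m' m x) = ip lam (root_density m) (root_density m').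
Proof.
move=> Pm Pm'; have [cu _] := unit_root_density Pm.
have [cu' _] := unit_root_density Pm'.
have q0 x : root_density m x != 0 by rewrite gt_eqF// root_density_gt0.
rewrite sqrt_RNd_ratio// (Rint_density cM (is_density_root Pm)).
  by apply: eq_Rintegral => x _; have := q0 x => ?; field.
by apply: contM => //; exact: contV.
Qed.

(** The angle is less than [pi / 2] because both roots are positive. *)
Lemma angle_root_density_bounds m m' : Pplus lam m -> Pplus lam m' ->
  let th := angle lam (root_density m) (root_density m') in
  0 <= th < pi / 2 /\ cos th = ip lam (root_density m) (root_density m').
Proof.
move=> Pm Pm' th.
have b := ip_unit_bound cM (unit_root_density Pm) (unit_root_density Pm').
have cosE : cos th = ip lam (root_density m) (root_density m').
  by apply: acosK; rewrite in_itv.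
have a0 : 0 <= th by exact: acos_ge0.
have pi0 := pi_gt0 R.
split => //; rewrite a0 ltNge; apply/negP => h.
have : cos th <= cos (pi / 2).
  rewrite leNgt ltr_cos ?in_itv/= ?a0 ?acos_lepi//.
    by rewrite -leNgt.
  by apply/andP; split; lra.
by rewrite cosE cos_pihalf leNgt ip_root_density_gt0.
Qed.

Lemma ellE m m' : Pplus lam m -> Pplus lam m' ->
  ell m m' = 2 * angle lam (root_density m) (root_density m').
Proof.
move=> Pm Pm'; have := angle_root_density_bounds Pm Pm'.
set th := angle _ _ _ => -[/andP[a0 api] cosE].
have pi0 := pi_gt0 R.
rewrite /ell Rint_sqrt_RNd//.
case: xgetP => [l _ [/andP[l0 lpi] lE]|]; last first.
  move=> /(_ (2 * th))[]; split; first by apply/andP; split; lra.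
  by rewrite mulrAC divff// mul1r cosE.
have : l / 2 = th.
  apply: cos_inj; rewrite ?in_itv/=; last by rewrite lE.
    by apply/andP; split; lra.
  by apply/andP; split; lra.
lra.
Qed.

(** The bounds for the pieces add up by the triangle inequality for angles. *)
Lemma angle_le_pw_length a s (c : R -> probability (borel M) R) :
  s <> [::] -> is_pw_curve lam a s c ->
  ((2 * angle lam (root_density (c a)) (root_density (c (last a s))))%:E <=
   pw_length lam a s c)%E.
Proof.
elim: s a => // b s IH a _ /= [cab].
have ab : a < b by case: cab.
have Pa : Pplus lam (c a) by case: cab => _ + _ _; apply; rewrite in_itv/= lexx ltW.
have Pb : Pplus lam (c b) by case: cab => _ + _ _; apply; rewrite in_itv/= lexx ltW.
have Lab := angle_le_length cM lam_full cab.
case: s IH => [_ _ /=|b' s IH pw]; first by rewrite adde0.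
have nn : b' :: s <> [::] by [].
have := IH b nn pw; set z := last b (b' :: s) => H.
apply: le_trans (leeD Lab H); rewrite -EFinD lee_fin -mulrDr ler_pM2l//.
have Pz : Pplus lam (c z).
  rewrite /z; move: pw; clear; elim: s b b' => [b b' /= [cbb' _]|b'' s IH b b' [_ pw]].
    by case: cbb' => bb' + _ _; apply; rewrite in_itv/= lexx ltW.
  exact: (IH b' b'' pw).
by apply: angle_triangle => //; exact: unit_root_density.
Qed.

Lemma ell_le_fisher_dist m m' : Pplus lam m -> Pplus lam m' ->
  ((ell m m')%:E <= fisher_dist lam m m')%E.
Proof.
move=> Pm Pm'; apply: le_ereal_inf_tmp => _ [a [s [c [[s0 pw ca cl] ->]]]].
rewrite ellE//.
have sym (m1 m2 : set (borel M) -> \bar R) : m1 =m m2 -> m2 =m m1.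
  by move=> h A mA; rewrite h.
rewrite (eqm_root_density Pm (sym _ _ ca)) (eqm_root_density Pm' (sym _ _ cl)).
exact: angle_le_pw_length.
Qed.

End distance_lower_bound.

(** * Great circles of square-root densities *)

Section C2_of_formula.
Context {R : realType}.
Variables (a b : R) (u F F1 F2 : R -> R).
Hypotheses (ab : a < b) (uF : forall t, t \in `[a, b] -> u t = F t).
Hypothesis dF : forall t : R, is_derive t 1 F (F1 t).
Hypothesis dF1 : forall t : R, is_derive t 1 F1 (F2 t).
Hypothesis cF2 : continuous F2.

Lemma slope_on_formula (u0 G : R -> R) d (t : R) :
  (forall s, s \in `[a, b] -> u0 s = G s) -> is_derive t 1 G d ->
  t \in `[a, b] -> cvg (slope_on `[a, b] u0 t) /\ derive_on `[a, b] u0 t = d.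
Proof.
move=> uG dG tab; apply: slope_on_cvg => //.
rewrite (@slope_on_eq _ _ u0 G) //; first exact: is_derive_slope_on.
by move=> s; rewrite inE; exact: uG.
Qed.

Lemma derive_on_formula t : t \in `[a, b] -> derive_on `[a, b] u t = F1 t.
Proof. by move=> tab; have [] := slope_on_formula uF (dF t) tab. Qed.

Lemma derive2_on_formula t : t \in `[a, b] ->
  derive_on `[a, b] (derive_on `[a, b] u) t = F2 t.
Proof. by move=> tab; have [] := slope_on_formula derive_on_formula (dF1 t) tab. Qed.

(** On [[a, b]] the function [u] is given by a formula that is smooth on the
    whole line, so that its one-sided derivatives are ordinary ones. *)
Lemma C2_on_formula : C2_on `[a, b] u.
Proof.
split.
- by move=> t tab; have [] := slope_on_formula uF (dF t) tab.
- by move=> t tab; have [] := slope_on_formula derive_on_formula (dF1 t) tab.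
- apply/cont_itvP => t tab; rewrite derive2_on_formula//.
  have c : F2 @ within `[a, b] (nbhs t) --> F2 t.
    by apply: cvg_within_filter; exact: cF2.
  apply: cvg_trans c; apply: near_eq_cvg.
  apply: (@filterE _ (nbhs t)) => s sab.
  by rewrite derive2_on_formula.
Qed.

End C2_of_formula.

Section half_angle.
Context {R : realType}.

Lemma is_derive_half (t : R) : is_derive t 1 (fun s : R => s / 2) 2^-1.
Proof.
rewrite (_ : (fun s : R => s / 2) = (2^-1 : R) \*: (@id R)); last first.
  by apply/funext => s; rewrite /= /GRing.scale/= mulrC.
by apply: is_derive_eq; rewrite /GRing.scale/= mulr1.
Qed.

Lemma is_derive_half_angle (A B t : R) :
  is_derive t 1 (fun s : R => cos (s / 2) * A + sin (s / 2) * B)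
    (2^-1 * (- sin (t / 2) * A + cos (t / 2) * B)).
Proof.
have h := is_derive_half t.
have dc := @is_derive1_comp _ cos (fun s : R => s / 2) t _ _
  (is_derive_cos (t / 2)) h.
have ds := @is_derive1_comp _ sin (fun s : R => s / 2) t _ _
  (is_derive_sin (t / 2)) h.
rewrite (_ : (fun s : R => _) = (A \*: (cos \o (fun s : R => s / 2)) : R -> R)
   + (B \*: (sin \o (fun s : R => s / 2)) : R -> R)); last first.
  by apply/funext => s; rewrite [cos _ * A]mulrC [sin _ * B]mulrC.
by apply: is_derive_eq; rewrite /GRing.scale/=; ring.
Qed.

Lemma is_derive_prod (f g : R -> R) (df dg t : R) :
  is_derive t 1 f df -> is_derive t 1 g dg ->
  is_derive t 1 (fun s => f s * g s) (f t * dg + g t * df).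
Proof. by move=> hf hg; exact: (@is_deriveM _ _ f g t 1 df dg hf hg). Qed.

Lemma is_derive_sub (f g : R -> R) (df dg t : R) :
  is_derive t 1 f df -> is_derive t 1 g dg ->
  is_derive t 1 (fun s => f s - g s) (df - dg).
Proof. by move=> hf hg; exact: (@is_deriveB _ _ _ f g t 1 df dg hf hg). Qed.

End half_angle.

Section great_circle.
Context {R : realType} {M : ptopologicalType} (lam : probability (borel M) R).
Hypotheses (cM : compact [set: M]) (lam_full : full_support lam).

Lemma Rint_eq0 (h : M -> R) : continuous h -> (forall x, 0 <= h x) ->
  \int[lam]_x h x = 0 -> forall x, h x = 0.
Proof.
move=> ch h0 hI x.
have mh := continuous_borel ch.
have I0 : (\int[lam]_x `|(h x)%:E| = 0)%E.
  transitivity (\int[lam]_x (h x)%:E)%E.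
    by apply: eq_integral => y _; rewrite gee0_abs// lee_fin.
  by rewrite -(EFin_Rint lam cM)// hI.
have me : measurable_fun [set: borel M] (EFin \o h) by exact/measurable_EFinP.
have E := (ae_eq_integral_abs lam measurableT me).1 I0.
suff -> : h = fun=> 0 by [].
apply: (continuous_ae_eq lam_full) => //; first exact: contC.
by move: E; apply: ae_impl => y /(_ I) [].
Qed.

Variables (mu mu1 : probability (borel M) R).
Hypotheses (Pmu : Pplus lam mu) (Pmu1 : Pplus lam mu1).
Hypothesis mu_neq : ~ (mu =m mu1).

Local Notation p := (root_density lam mu).
Local Notation p1 := (root_density lam mu1).
Local Notation l := (ell mu mu1).

Let cp : continuous p. Proof. by have [] := unit_root_density cM lam_full Pmu. Qed.
Let cp1 : continuous p1. Proof. by have [] := unit_root_density cM lam_full Pmu1. Qed.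
Let ipp : ip lam p p = 1. Proof. by have [] := unit_root_density cM lam_full Pmu. Qed.
Let ip11 : ip lam p1 p1 = 1. Proof. by have [] := unit_root_density cM lam_full Pmu1. Qed.
Let p_gt0 x : 0 < p x. Proof. exact: root_density_gt0. Qed.
Let p1_gt0 x : 0 < p1 x. Proof. exact: root_density_gt0. Qed.

Lemma ell_bounds : 0 <= l < pi /\ cos (l / 2) = ip lam p p1.
Proof.
have := angle_root_density_bounds cM lam_full Pmu Pmu1.
rewrite (ellE cM lam_full Pmu Pmu1) /=.
set th := angle _ _ _ => -[/andP[a0 api] cosE].
rewrite mulrAC divff// mul1r; split => //.
by apply/andP; split; lra.
Qed.

(** At angle zero the chord between the two unit vectors vanishes. *)
Lemma ell_gt0 : 0 < l.
Proof.
have [/andP[l0 lpi] lE] := ell_bounds.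
rewrite lt_neqAle l0 andbT; apply/eqP => l0E; apply: mu_neq.
have i1 : ip lam p p1 = 1 by rewrite -lE -l0E mul0r cos0.
have cd : continuous (fun x => p1 x - p x) by exact: contB.
have := ip_chord cM (unit_root_density cM lam_full Pmu) (unit_root_density cM lam_full Pmu1).
rewrite i1 mulr1 subrr => /(Rint_eq0 (contM cd cd)) H.
have pE : p = p1.
  apply/funext => x; apply/esym/eqP; rewrite -subr_eq0 -sqrf_eq0 expr2; apply/eqP.
  by apply: H => y; rewrite -expr2 sqr_ge0.
move=> A mA; have [_ _ ->//] := is_density_root cM lam_full Pmu.
by have [_ _ ->//] := is_density_root cM lam_full Pmu1; rewrite pE.
Qed.

Local Notation C := (cos (l / 2)).
Local Notation S := (sin (l / 2)).

Lemma sin_half_ell_gt0 : 0 < S.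
Proof.
have [/andP[_ lpi] _] := ell_bounds; have l0 := ell_gt0.
by apply: sin_gt0_pi; apply/andP; split; lra.
Qed.

Lemma cos_half_ell_gt0 : 0 < C.
Proof. by have [_ ->] := ell_bounds; exact: ip_root_density_gt0. Qed.

(** The unit vector orthogonal to [p] in the plane of [p] and [p1], on the side
    of [p1]: Gram-Schmidt. *)
Definition circle_dir (x : M) : R := S^-1 * p1 x + (- (C / S)) * p x.
Local Notation w := circle_dir.

Let cw : continuous w.
Proof. by apply: contD; apply: contM => //; exact: contC. Qed.

Let S0 : S != 0. Proof. by rewrite gt_eqF// sin_half_ell_gt0. Qed.

Lemma ip_p_dir : ip lam p w = 0.
Proof.
rewrite ipC ip_lin// ipp (ipC _ p1) -(proj2 ell_bounds).
by field.
Qed.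

Lemma ip_dir_dir : ip lam w w = 1.
Proof.
rewrite ip_sqr// ipp ip11 (ipC _ p1) -(proj2 ell_bounds).
have := cos2Dsin2 (l / 2); move: S0; move: C S => C' S' S'0 E.
transitivity ((1 - C' ^+ 2) / S' ^+ 2); first by field.
by rewrite -E addrC addKr divff// expf_neq0.
Qed.

(** The great circle from [p] to [p1], at half unit speed since the Fisher
    metric is four times the L2 metric, and its time derivative. *)
Definition circle (x : M) (t : R) : R := cos (t / 2) * p x + sin (t / 2) * w x.
Definition circle1 (x : M) (t : R) : R :=
  2^-1 * (- sin (t / 2) * p x + cos (t / 2) * w x).

Lemma continuous_circle t : continuous (circle^~ t).
Proof. by apply: contD; apply: contM => //; exact: contC. Qed.

Lemma continuous_circle1 t : continuous (circle1^~ t).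
Proof.
apply: contM; first exact: contC.
by apply: contD; apply: contM => //; exact: contC.
Qed.

Lemma circle0 x : circle x 0 = p x.
Proof. by rewrite /circle mul0r cos0 sin0 mul1r mul0r addr0. Qed.

Lemma circle_ell x : circle x l = p1 x.
Proof. by rewrite /circle /w; field. Qed.

Lemma circle_sinE x t :
  circle x t * S = p x * sin (l / 2 - t / 2) + p1 x * sin (t / 2).
Proof. by rewrite /circle /w sinB; field. Qed.

(** Between its end points the circle is a combination of [p] and [p1] with
    nonnegative coefficients that do not vanish together. *)
Lemma circle_gt0 x t : t \in `[0, l] -> 0 < circle x t.
Proof.
rewrite in_itv/= => /andP[t0 tl].
have [/andP[_ lpi] _] := ell_bounds.
rewrite -(pmulr_lgt0 _ sin_half_ell_gt0) circle_sinE.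
have l0 := ell_gt0.
have s1 : 0 <= sin (l / 2 - t / 2) by apply: sin_ge0_pi; apply/andP; split; lra.
have s2 : 0 <= sin (t / 2) by apply: sin_ge0_pi; apply/andP; split; lra.
have [t0'|t0'] := eqVneq t 0.
  rewrite t0' mul0r subr0 sin0 mulr0 addr0 mulr_gt0//.
  exact: sin_half_ell_gt0.
have : 0 < sin (t / 2).
  have tp : 0 < t by rewrite lt0r t0'.
  by apply: sin_gt0_pi; apply/andP; split; lra.
by move=> s3; rewrite ltr_wpDl ?mulr_gt0// mulr_ge0// ltW.
Qed.

Lemma ip_circle t : ip lam (circle^~ t) (circle^~ t) = 1.
Proof.
rewrite /circle ip_sqr// ipp ip_dir_dir ip_p_dir.
by rewrite -[RHS](cos2Dsin2 (t / 2)); ring.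
Qed.

Lemma ip_circle1 t : ip lam (circle1^~ t) (circle1^~ t) = 4^-1.
Proof.
pose u x := - sin (t / 2) * p x + cos (t / 2) * w x.
have cu : continuous u by apply: contD; apply: contM => //; exact: contC.
transitivity (4^-1 * ip lam u u).
  rewrite -RintZ//; last exact: contM.
  by apply: eq_Rintegral => x _; rewrite /circle1 /u; field.
rewrite ip_sqr// ipp ip_dir_dir ip_p_dir.
transitivity (4^-1 * (cos (t / 2) ^+ 2 + sin (t / 2) ^+ 2)); first by ring.
by rewrite cos2Dsin2 mulr1.
Qed.

Lemma ip_circle_circle1 t : ip lam (circle^~ t) (circle1^~ t) = 0.
Proof.
have c1 := continuous_circle1 (t := t).
rewrite /circle ip_lin//.
have E (f : M -> R) : continuous f -> ip lam f (circle1^~ t) =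
    2^-1 * (- sin (t / 2) * ip lam p f + cos (t / 2) * ip lam w f).
  move=> cf; pose u x := - sin (t / 2) * p x + cos (t / 2) * w x.
  have cu : continuous u by apply: contD; apply: contM => //; exact: contC.
  rewrite -(ip_lin lam cM) // -(RintZ lam cM); last exact: contM.
  by apply: eq_Rintegral => x _; rewrite /circle1; ring.
rewrite !E// ipp ip_dir_dir (ipC _ w) ip_p_dir; ring.
Qed.

Let dens (x : M) (t : R) : R := circle x t ^+ 2.
Let dens1 (x : M) (t : R) : R := 2 * (circle x t * circle1 x t).
Let dens2 (x : M) (t : R) : R :=
  2 * circle1 x t ^+ 2 - 2^-1 * circle x t ^+ 2.

Lemma is_derive_circle x (t : R) : is_derive t 1 (circle x) (circle1 x t).
Proof. exact: is_derive_half_angle. Qed.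

Lemma is_derive_circle1 x (t : R) :
  is_derive t 1 (circle1 x) (- 4^-1 * circle x t).
Proof.
rewrite (_ : circle1 x =
  fun s => cos (s / 2) * (2^-1 * w x) + sin (s / 2) * (- 2^-1 * p x)); last first.
  by apply/funext => s; rewrite /circle1; ring.
have := is_derive_half_angle (2^-1 * w x) (- 2^-1 * p x) t.
by congr (is_derive _ _ _ _); rewrite /circle; field.
Qed.

Lemma is_derive_dens x (t : R) : is_derive t 1 (dens x) (dens1 x t).
Proof.
rewrite (_ : dens x = fun s => circle x s * circle x s); last first.
  by apply/funext => s; rewrite /dens expr2.
have := is_derive_prod (is_derive_circle x t) (is_derive_circle x t).
by congr (is_derive _ _ _ _); rewrite /dens1; ring.
Qed.

Lemma is_derive_dens1 x (t : R) : is_derive t 1 (dens1 x) (dens2 x t).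
Proof.
have H := is_derive_prod (is_derive_circle x t) (is_derive_circle1 x t).
have := is_derive_prod (is_derive_cst (2 : R) t 1) H.
by congr (is_derive _ _ _ _); rewrite /dens2; field.
Qed.

Let continuous_dens2 x : continuous (dens2 x).
Proof.
have cc : continuous (circle x).
  move=> t; apply: differentiable_continuous; apply/derivable1_diffP.
  by have [] := is_derive_circle x t.
have cc1 : continuous (circle1 x).
  move=> t; apply: differentiable_continuous; apply/derivable1_diffP.
  by have [] := is_derive_circle1 x t.
by apply: contB; apply: contM; (exact: contC || exact: contX).
Qed.

(** Outside [[0, ell]] the curve takes an arbitrary value. *)
Lemma exists_circle_curve : exists c : R -> probability (borel M) R,
  forall t, t \in `[0, l] -> is_density lam (c t) (dens^~ t).
Proof.
suff : forall t, exists m : probability (borel M) R,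
    t \in `[0, l] -> is_density lam m (dens^~ t).
  by move=> /choice[c cP]; exists c.
move=> t; have [tl|] := boolP (t \in `[0, l]); last by exists mu.
have cdt : continuous (dens^~ t) by apply: contX; exact: continuous_circle.
have [||m mP] := @probability_of_wmeas _ _ lam (dens^~ t) cdt.
- by move=> x; rewrite exprn_gt0// circle_gt0.
- rewrite /wmeas -EFin_Rint// -(ip_circle t); congr EFin.
- by exists m.
Qed.

Section circle_curve.
Variable c : R -> probability (borel M) R.
Hypothesis cP : forall t, t \in `[0, l] -> is_density lam (c t) (dens^~ t).

Let l0 := ell_gt0.

Lemma curve_dens_circle x t : t \in `[0, l] -> curve_dens lam c x t = dens x t.
Proof. by move=> tl; rewrite /curve_dens (RNd_density cM lam_full (cP tl)). Qed.

Let d1 x t : t \in `[0, l] ->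
  derive_on `[0, l] (curve_dens lam c x) t = dens1 x t.
Proof.
by apply: (@derive_on_formula _ 0 l _ (dens x)) => // s; [exact: curve_dens_circle|exact: is_derive_dens].
Qed.

Let d2 x t : t \in `[0, l] ->
  derive_on `[0, l] (derive_on `[0, l] (curve_dens lam c x)) t = dens2 x t.
Proof.
apply: (@derive2_on_formula _ 0 l _ (dens x) (dens1 x)) => // s.
- exact: curve_dens_circle.
- exact: is_derive_dens.
- exact: is_derive_dens1.
Qed.

Let continuous_dens1 t : continuous (dens1^~ t).
Proof.
apply: contM; first exact: contC.
by apply: contM; [exact: continuous_circle|exact: continuous_circle1].
Qed.

Lemma circle_velocity t : t \in `[0, l] ->
  velocity lam 0 l c t =m wmeas lam (dens1^~ t).
Proof. by move=> tl A mA; rewrite /velocity; apply: eq_integral => x _; rewrite d1. Qed.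

Lemma circle_acceleration t : t \in `[0, l] ->
  acceleration lam 0 l c t =m wmeas lam (dens2^~ t).
Proof. by move=> tl A mA; rewrite /acceleration; apply: eq_integral => x _; rewrite d2. Qed.

Lemma circle_is_curve : is_curve lam 0 l c.
Proof.
split => //.
- by move=> t tl; apply/PplusP; exists (dens^~ t); exact: cP.
- move=> x; apply: (@C2_on_formula _ 0 l _ (dens x) (dens1 x) (dens2 x)) => // s.
  + exact: curve_dens_circle.
  + exact: is_derive_dens.
  + exact: is_derive_dens1.
- move=> t tl; exists (dens1^~ t); split => //; last exact: circle_velocity.
  rewrite /wmeas -EFin_Rint//; congr EFin.
  rewrite /dens1 RintZ//; last first.
    by apply: contM; [exact: continuous_circle|exact: continuous_circle1].
  by rewrite -/(ip lam (circle^~ t) (circle1^~ t)) ip_circle_circle1 mulr0.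
Qed.

Lemma circle_fisher (m : probability (borel M) R) t : t \in `[0, l] ->
  is_density lam m (dens^~ t) ->
  fisher m (velocity lam 0 l c t) (velocity lam 0 l c t) = 1.
Proof.
move=> tl mP.
rewrite (fisher_eq cM lam_full mP (@continuous_dens1 t) (circle_velocity tl)
  (@continuous_dens1 t) (circle_velocity tl)).
have q0 x : circle x t != 0 by rewrite gt_eqF// circle_gt0.
transitivity (4 * ip lam (circle1^~ t) (circle1^~ t)); last first.
  by rewrite ip_circle1 divff.
rewrite -RintZ//; last by apply: contM; exact: continuous_circle1.
by apply: eq_Rintegral => x _; rewrite /dens1 /dens; have := q0 x => ?; field.
Qed.

Lemma circle_length : curve_length lam 0 l c = l%:E.
Proof.
rewrite /curve_length.
under eq_integral => t tl.
  rewrite /fisher_norm circle_fisher//; last 2 first.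
  - by move: tl; rewrite inE.
  - by apply: cP; move: tl; rewrite inE.
  rewrite sqrtr1; over.
rewrite integral_cst//= mul1e lebesgue_measure_itv/= lte_fin l0.
by rewrite -EFinB subr0.
Qed.

(** With [q] the circle, the acceleration has density [2 q'^2 - q^2 / 2]; the
    Levi-Civita term for unit speed has the opposite density. *)
Lemma circle_geodesic : geodesic lam 0 l c.
Proof.
split; first exact: circle_is_curve.
move=> t tl A mA /=; rewrite circle_acceleration//.
have mP := cP tl.
rewrite /levi_civita circle_fisher//.
rewrite (RNd_eq cM lam_full mP (@continuous_dens1 t) (circle_velocity tl)).
have q0 x : circle x t != 0 by rewrite gt_eqF// circle_gt0.
have d0 x : dens x t != 0 by rewrite expf_neq0.
have cd : continuous (dens^~ t) by case: mP.
have cr : continuous (fun x => dens1 x t / dens x t).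
  by apply: contM => //; exact: contV.
rewrite (wmeas_density cM mP)//; last first.
  apply: contM; first exact: contC.
  by apply: contB; [exact: contM|exact: contC].
set f2 := (X in (_ + wmeas lam X A)%E).
have -> : f2 = fun x => -1 * dens2 x t.
  apply/funext => x; rewrite /f2 /dens2 /dens1 /dens.
  by have := q0 x => ?; field.
have cd2 : continuous (dens2^~ t).
  by apply: contB; apply: contM; (exact: contC || apply: contX);
    [exact: continuous_circle1|exact: continuous_circle].
rewrite wmeasZ// EFinN mulN1e subee//; exact: wmeas_fin.
Qed.

Lemma circle_start : c 0 =m mu.
Proof.
move=> A mA; have tl : 0 \in `[0, l] by rewrite in_itv/= lexx ltW.
have [_ _ ->//] := cP tl.
have [_ _ ->//] := is_density_root cM lam_full Pmu.
by apply: eq_integral => x _; rewrite /dens circle0.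
Qed.

Lemma circle_end : c l =m mu1.
Proof.
move=> A mA; have tl : l \in `[0, l] by rewrite in_itv/= lexx ltW.
have [_ _ ->//] := cP tl.
have [_ _ ->//] := is_density_root cM lam_full Pmu1.
by apply: eq_integral => x _; rewrite /dens circle_ell.
Qed.

Lemma circle_unit_geodesic : unit_geodesic_segment lam l c mu mu1.
Proof.
split.
- exact: circle_geodesic.
- exact: circle_start.
- exact: circle_end.
- have tl : 0 \in `[0, l] by rewrite in_itv/= lexx ltW.
  rewrite /fisher_norm circle_fisher ?sqrtr1//.
  rewrite (_ : dens^~ 0 = fun x => p x ^+ 2); first exact: is_density_root.
  by apply/funext => x; rewrite /dens circle0.
- by case: circle_is_curve.
Qed.

Lemma circle_joins : joins lam 0 [:: l] c mu mu1.
Proof.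
split => //=; first by split => //; exact: circle_is_curve.
- exact: circle_start.
- exact: circle_end.
Qed.

(** The initial velocity has [lam]-density [w p], because
    [1 / (tan (ell / 2) cos (ell / 2)) = 1 / sin (ell / 2)]. *)
Lemma RNd_init_velocity : RNd (init_velocity mu mu1) mu = fun x => w x / p x.
Proof.
have q0 x : p x != 0 by rewrite gt_eqF.
have mP := is_density_root cM lam_full Pmu; have [cpp _ muE] := mP.
have cwp : continuous (fun x => w x * p x) by exact: contM.
have C0 : C != 0 by rewrite gt_eqF// cos_half_ell_gt0.
have tE : init_velocity mu mu1 =m wmeas lam (fun x => w x * p x).
  move=> A mA; rewrite /init_velocity /geom_mean.
  have cr : continuous (fun x => p1 x / p x) by apply: contM => //; exact: contV.
  have -> : (fun x => C^-1 * Num.sqrt (RNd mu1 mu x)) = (fun x => C^-1 * (p1 x / p x)).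
    apply/funext => x; have /(congr1 (fun f => f x)) /= -> := sqrt_RNd_ratio cM lam_full Pmu Pmu1.
    by [].
  rewrite (wmeas_density cM mP)//; last by apply: contM => //; exact: contC.
  rewrite muE//.
  have -> : (fun x => C^-1 * (p1 x / p x) * p x ^+ 2) = (fun x => C^-1 * (p1 x * p x)).
    by apply/funext => x; field; rewrite C0 q0.
  have -> : (fun x => w x * p x) = (fun x => (tan (l / 2))^-1 *
      (C^-1 * (p1 x * p x) + -1 * p x ^+ 2)).
    by apply/funext => x; rewrite /w /tan; field; rewrite S0 C0.
  have c1 : continuous (fun x => C^-1 * (p1 x * p x)).
    by apply: contM; [exact: contC|exact: contM].
  have c2 : continuous (fun x => -1 * p x ^+ 2) by apply: contM => //; exact: contC.
  rewrite (wmeasZ lam cM (tan (l / 2))^-1 (contD c1 c2) mA).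
  have cpp' : continuous (fun x => p x ^+ 2) by [].
  by rewrite (wmeasD lam cM c1 c2 mA) (wmeasZ lam cM (-1) cpp' mA) EFinN mulN1e.
rewrite (RNd_eq cM lam_full mP cwp tE).
by apply/funext => x; have := q0 x => ?; field.
Qed.

Lemma circle_formula t : t \in `[0, l] ->
  c t =m wmeas mu (fun x =>
    (cos (t / 2) + sin (t / 2) * RNd (init_velocity mu mu1) mu x) ^+ 2).
Proof.
move=> tl A mA; have [_ _ ->//] := cP tl.
have q0 x : p x != 0 by rewrite gt_eqF.
have mP := is_density_root cM lam_full Pmu.
rewrite RNd_init_velocity (wmeas_density cM mP)//; last first.
  apply: contX; apply: contD; first exact: contC.
  by apply: contM; [exact: contC|apply: contM => //; exact: contV].
by apply: eq_integral => x _; rewrite /dens /circle; have := q0 x => ?; congr EFin; field.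
Qed.

End circle_curve.
End great_circle.

(** * Conservation of energy along geodesics *)

Section dense_times.
Context {R : realType}.
Variables (a b : R).
Hypothesis (ab : a <= b).

(** A countable dense set of times: the rationals, moved into [[a, b]]. *)
Definition dense_time (k : nat) : R :=
  clamp a b (if unpickle k is Some r then ratr (r : rat) else 0).

Lemma dense_time_in k : dense_time k \in `[a, b].
Proof. exact: clamp_in. Qed.

Lemma cont_itv_eq0 (u : R -> R) : cont_itv a b u ->
  (forall k, u (dense_time k) = 0) -> forall t, t \in `[a, b] -> u t = 0.
Proof.
move=> cu u0 t tab; have c := cont_clamp ab cu.
rewrite -(clamp_id tab); apply: contrapT => /eqP neq.
have near0 : \forall s \near t, (u \o clamp a b) s != 0.
  exact: (cvgr_neq0 _ (c t)).
have : (interior [set s | (u \o clamp a b) s != 0]) !=set0 by exists t.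
move=> /(@dense_rat R _)[|s [/interior_subset/= us [r _ rs]]].
  exact: open_interior.
have := u0 (pickle r); rewrite /dense_time pickleK rs => E.
by rewrite E eqxx in us.
Qed.

End dense_times.

Section conservation.
Context {R : realType} {M : ptopologicalType} (lam : probability (borel M) R).
Hypotheses (cM : compact [set: M]) (lam_full : full_support lam).

(** The Gram determinant of [(u, v)] is half the double integral of the square
    of [u x * v y - v x * u y], so it depends on these minors only. *)
Lemma ip_gram (u v u' v' : M -> R) :
  continuous u -> continuous v -> continuous u' -> continuous v' ->
  (forall x y, u x * v y - v x * u y = u' x * v' y - v' x * u' y) ->
  ip lam u u * ip lam v v - ip lam u v ^+ 2 =
  ip lam u' u' * ip lam v' v' - ip lam u' v' ^+ 2.
Proof.
move=> cu cv cu' cv' uv.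
have E (f g : M -> R) : continuous f -> continuous g ->
    \int[lam]_x (ip lam (fun y => f x * g y + (- g x) * f y)
                        (fun y => f x * g y + (- g x) * f y)) =
    2 * (ip lam f f * ip lam g g - ip lam f g ^+ 2).
  move=> cf cg.
  transitivity (\int[lam]_x (ip lam g g * (f x * f x) +
     (- 2 * ip lam f g * (f x * g x) + ip lam f f * (g x * g x)))).
    by apply: eq_Rintegral => x _; rewrite ip_sqr// (ipC _ g f); ring.
  have c1 : continuous (fun x => ip lam g g * (f x * f x)).
    by apply: contM; [exact: contC|exact: contM].
  have c2 : continuous (fun x => - 2 * ip lam f g * (f x * g x)).
    by apply: contM; [exact: contC|exact: contM].
  have c3 : continuous (fun x => ip lam f f * (g x * g x)).
    by apply: contM; [exact: contC|exact: contM].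
  rewrite RintD//; last exact: contD.
  rewrite RintD// !RintZ//; [|exact: contM..].
  by rewrite -!/(ip lam _ _); ring.
apply: (@mulfI R 2); first by rewrite pnatr_eq0.
rewrite -(E u v cu cv) -(E u' v' cu' cv'); apply: eq_Rintegral => x _; apply: eq_Rintegral => y _.
by rewrite !mulNr !uv.
Qed.

Variables (l : R) (c : R -> probability (borel M) R).
Hypothesis (geo : geodesic lam 0 l c).

Let cc : is_curve lam 0 l c. Proof. by case: geo. Qed.
Let l0 : 0 < l. Proof. by case: cc. Qed.

Local Notation q := (croot_val lam c).
Local Notation q1 := (croot_vel lam 0 l c).
Local Notation q2 := (croot_acc lam 0 l c).
Local Notation vel := (velocity lam 0 l c).

Definition energy t : R := fisher (c t) (vel t) (vel t).

Local Notation tgrid := (@dense_time R 0 l).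

(** At every time the geodesic equation fails on a null set only; imposing it
    at countably many times keeps the set of exceptional points null.  The
    energy is not known to be continuous at this stage, so that the equation
    cannot yet be extended to other times. *)
Definition regular_point (x : M) := forall k : nat,
  q2 x (tgrid k) = - (energy (tgrid k) / 4) * q x (tgrid k).

Lemma ae_regular : {ae lam, forall x, regular_point x}.
Proof.
apply: (@ae_foralln _ (borel M)) => k.
apply: (curve_root_acceleration cM lam_full cc _ geo).
by apply: dense_time_in; exact: ltW.
Qed.

Let u_gt0 x t : t \in `[0, l] -> 0 < curve_dens lam c x t.
Proof. by move=> tl; have [_ + _] := curve_density cM lam_full cc tl; apply. Qed.
Let uC2 x : C2_on `[0, l] (curve_dens lam c x). Proof. by case: cc. Qed.

Let cq x : cont_itv 0 l (q x).
Proof. by apply: cont_root_val; [exact: uC2]. Qed.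
Let cq1 x : cont_itv 0 l (q1 x).
Proof. by apply: cont_root_vel; [exact: uC2|exact: u_gt0]. Qed.
Let cq2 x : cont_itv 0 l (q2 x).
Proof. by apply: cont_root_acc; [exact: uC2|exact: u_gt0]. Qed.
Let dq x t : t \in `]0, l[ -> is_derive t 1 (q x) (q1 x t).
Proof. by apply: is_derive_root_val; [exact: uC2|exact: u_gt0]. Qed.
Let dq1 x t : t \in `]0, l[ -> is_derive t 1 (q1 x) (q2 x t).
Proof. by apply: is_derive_root_vel; [exact: uC2|exact: u_gt0]. Qed.

(** Both roots satisfy [q'' = - (energy / 4) q] at the dense times with the same
    coefficient, so [q x * q'' y - q'' x * q y] vanishes there; being continuous
    in time it vanishes always, and it is the derivative of the Wronskian. *)
Lemma regular_wronskian_const x y : regular_point x -> regular_point y ->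
  forall t, t \in `[0, l] ->
  q x t * q1 y t - q1 x t * q y t = q x 0 * q1 y 0 - q1 x 0 * q y 0.
Proof.
move=> rx ry.
have W0 t : t \in `[0, l] -> q x t * q2 y t - q2 x t * q y t = 0.
  apply: (@cont_itv_eq0 _ _ _ (ltW l0) (fun t => q x t * q2 y t - q2 x t * q y t)).
    by move=> s sl; apply: cvgB; apply: cvgM; (exact: cq || exact: cq2).
  by move=> k; rewrite rx ry; ring.
apply: (@const_of_derive0 _ 0 l (fun t => q x t * q1 y t - q1 x t * q y t) (ltW l0)).
  by move=> s sl; apply: cvgB; apply: cvgM; (exact: cq || exact: cq1).
move=> t tl.
have tl' : t \in `[0, l] by exact: subset_itv_oo_cc.
have H1 := is_derive_prod (dq x tl) (dq1 y tl).
have H2 := is_derive_prod (dq1 x tl) (dq y tl).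
have := is_derive_sub H1 H2.
by congr (is_derive _ _ _ _); rewrite -[RHS](W0 t tl'); ring.
Qed.

(** The minors of the pair of the position and the velocity are the Wronskians,
    which are constant in time, so its Gram determinant is too.  The position
    is a unit vector orthogonal to the velocity: this determinant is a quarter
    of the energy. *)
Lemma energy_const t : t \in `[0, l] -> energy t = energy 0.
Proof.
move=> tl; have l00 : 0 \in `[0, l] by rewrite in_itv/= lexx ltW.
have [g [cg qg aeg fg]] := curve_root_velocity cM lam_full cc tl.
have [g0 [cg0 qg0 aeg0 fg0]] := curve_root_velocity cM lam_full cc l00.
have ct := continuous_croot_val cM lam_full cc tl.
have c0 := continuous_croot_val cM lam_full cc l00.
have good := ae_conj ae_regular (ae_conj aeg aeg0).
(* The identity of minors extends from regular points to all points, first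
   in [y] and then in [x], by continuity. *)
have H1 x : (regular_point x /\ q1 x t = g x /\ q1 x 0 = g0 x) ->
    forall y, q x t * g y - g x * q y t = q x 0 * g0 y - g0 x * q y 0.
  move=> [rx [gx g0x]] y.
  have E : (fun y => q x t * g y - g x * q y t) =
           (fun y => q x 0 * g0 y - g0 x * q y 0).
    apply: (continuous_ae_eq lam_full).
    - by apply: contB; apply: contM => //; exact: contC.
    - by apply: contB; apply: contM => //; exact: contC.
    - apply: ae_impl good => z [rz [gz g0z]].
      by rewrite -gx -g0x -gz -g0z; exact: regular_wronskian_const.
  exact: (congr1 (fun f => f y) E).
have H2 x y : q x t * g y - g x * q y t = q x 0 * g0 y - g0 x * q y 0.
  have E : (fun x => q x t * g y - g x * q y t) =
           (fun x => q x 0 * g0 y - g0 x * q y 0).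
    apply: (continuous_ae_eq lam_full).
    - by apply: contB; apply: contM => //; exact: contC.
    - by apply: contB; apply: contM => //; exact: contC.
    - by apply: ae_impl good => z gz; exact: H1.
  exact: (congr1 (fun f => f x) E).
have := ip_gram ct cg c0 cg0 H2.
rewrite (ip_croot_val cM lam_full cc tl) (ip_croot_val cM lam_full cc l00) qg qg0.
by rewrite /energy fg fg0 expr0n !mul1r !subr0 => ->.
Qed.

Hypothesis energy0 : energy 0 = 1.

Lemma regular_oscillator x : regular_point x -> forall t, t \in `[0, l] ->
  q2 x t = - 4^-1 * q x t.
Proof.
move=> rx t tl; apply/eqP; rewrite -subr_eq0; apply/eqP.
apply: (@cont_itv_eq0 _ _ _ (ltW l0) (fun t => q2 x t - - 4^-1 * q x t)) => //.
  move=> s sl; apply: cvgB; first exact: cq2.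
  by apply: cvgM; [exact: cvg_cst|exact: cq].
move=> k; have tk : tgrid k \in `[0, l] by apply: dense_time_in; exact: ltW.
by rewrite rx energy_const// energy0 mul1r subrr.
Qed.

(** With unit energy, [q'' = - q / 4].  The quantity
    [q phi - 2 q' psi], with [phi] any solution of the same equation and
    [psi = - 2 phi'], is constant; a suitable [phi] isolates [q x t] at each
    time. *)
Lemma regular_solution x : regular_point x -> forall t, t \in `[0, l] ->
  q x t * sin (l / 2) = q x 0 * sin (l / 2 - t / 2) + q x l * sin (t / 2).
Proof.
move=> rx.
have l00 : 0 \in `[0, l] by rewrite in_itv/= lexx ltW.
have ll : l \in `[0, l] by rewrite in_itv/= lexx ltW.
have ctrig (A B : R) : continuous (fun s : R => cos (s / 2) * A + sin (s / 2) * B).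
  move=> t; apply: differentiable_continuous; apply/derivable1_diffP.
  by have [] := is_derive_half_angle A B t.
(* [phi] has coordinates [A] and [B] on the cosine and the sine; [psi] is
   the second bracket. *)
have inv (A B : R) t : t \in `[0, l] ->
    q x t * (cos (t / 2) * A + sin (t / 2) * B) -
    2 * q1 x t * (cos (t / 2) * - B + sin (t / 2) * A) = q x 0 * A + 2 * q1 x 0 * B.
  move=> tl.
  pose J s := q x s * (cos (s / 2) * A + sin (s / 2) * B) -
    2 * q1 x s * (cos (s / 2) * - B + sin (s / 2) * A).
  have -> : q x 0 * A + 2 * q1 x 0 * B = J 0.
    by rewrite /J mul0r cos0 sin0; ring.
  rewrite -/(J t).
  apply: (@const_of_derive0 _ 0 l J (ltW l0)) => //.
    move=> s sl; apply: cvgB; apply: cvgM.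
    - exact: cq.
    - by apply: cvg_within_filter; exact: ctrig.
    - by apply: cvgM; [exact: cvg_cst|exact: cq1].
    - by apply: cvg_within_filter; exact: ctrig.
  move=> s sl; have sl' : s \in `[0, l] by exact: subset_itv_oo_cc.
  have H1 := is_derive_prod (dq x sl) (is_derive_half_angle A B s).
  have H2 := is_derive_prod (is_derive_prod (is_derive_cst (2 : R) s 1) (dq1 x sl))
    (is_derive_half_angle (- B) A s).
  have := is_derive_sub H1 H2.
  by congr (is_derive _ _ _ _); rewrite regular_oscillator//; field.
have sol t : t \in `[0, l] ->
    q x t = q x 0 * cos (t / 2) + 2 * q1 x 0 * sin (t / 2).
  move=> tl; rewrite -(inv _ _ t tl).
  rewrite (_ : cos _ * cos _ + _ = 1); last by rewrite -!expr2 cos2Dsin2.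
  by rewrite mulr1; ring.
move=> t tl; rewrite (sol t tl) (sol l ll) sinB; ring.
Qed.

End conservation.

(** * Uniqueness of the geodesic, and the distance *)

Section uniqueness.
Context {R : realType} {M : ptopologicalType} (lam : probability (borel M) R).
Hypotheses (cM : compact [set: M]) (lam_full : full_support lam).
Variables (mu mu1 : probability (borel M) R).
Hypotheses (Pmu : Pplus lam mu) (Pmu1 : Pplus lam mu1).

(** Unit energy at time 0 is conserved, so at almost every point the square root
    of the density is the harmonic oscillation determined by its end values.  As
    [sin (ell / 2)] is not zero, these values determine it, and they are those of the great
    circle; by continuity in [x] the two coincide everywhere. *)
Lemma unit_geodesic_circle (c : R -> probability (borel M) R) :
  ~ (mu =m mu1) -> unit_geodesic_segment lam (ell mu mu1) c mu mu1 ->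
  forall t, t \in `[0, ell mu mu1] ->
  is_density lam (c t) (fun x => circle lam mu mu1 x t ^+ 2).
Proof.
move=> mu_neq [geo c0 cl speed0 _] t tl.
have cc : is_curve lam 0 (ell mu mu1) c by case: geo.
have l0 := ell_gt0 cM lam_full Pmu Pmu1 mu_neq.
have l00 : 0 \in `[0, ell mu mu1] by rewrite in_itv/= lexx ltW.
have ll : ell mu mu1 \in `[0, ell mu mu1] by rewrite in_itv/= lexx ltW.
have S0 := sin_half_ell_gt0 cM lam_full Pmu Pmu1 mu_neq.
have energy0 : energy lam (ell mu mu1) c 0 = 1.
  have [h [ch _ _ vh]] := curve_velocity cM lam_full cc l00.
  have d0 := curve_density cM lam_full cc l00.
  have d0' : is_density lam mu (fun x => curve_dens lam c x 0).
    by case: d0 => cf f0 E; split => // A mA; rewrite -c0// E.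
  rewrite /energy (fisher_eq cM lam_full d0 ch vh ch vh).
  rewrite -(fisher_eq cM lam_full d0' ch vh ch vh).
  move: speed0; rewrite /fisher_norm => s1.
  rewrite -[LHS]sqr_sqrtr ?s1 ?expr1n// leNgt; apply/negP => neg.
  by move: s1; rewrite ltr0_sqrtr// => /esym/eqP; rewrite oner_eq0.
have P0 : Pplus lam (c 0) by case: cc => _ + _ _; apply.
have Pl : Pplus lam (c (ell mu mu1)) by case: cc => _ + _ _; apply.
have q0 x : croot_val lam c x 0 = root_density lam mu x.
  by rewrite -(eqm_root_density cM lam_full P0 c0).
have ql x : croot_val lam c x (ell mu mu1) = root_density lam mu1 x.
  by rewrite -(eqm_root_density cM lam_full Pl cl).
have ct : continuous ((circle lam mu mu1)^~ t) by exact: continuous_circle.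
have qE : (croot_val lam c)^~ t = (circle lam mu mu1)^~ t.
  apply: (continuous_ae_eq lam_full) => //.
    exact: (continuous_croot_val cM lam_full cc).
  apply: ae_impl (ae_regular cM lam_full geo) => x rx.
  apply: (mulIf (lt0r_neq0 S0)).
  rewrite (regular_solution cM lam_full geo energy0 rx tl).
  by rewrite q0 ql circle_sinE.
rewrite -(_ : (fun x => curve_dens lam c x t) = (fun x => circle lam mu mu1 x t ^+ 2)).
  exact: (curve_density cM lam_full cc).
apply/funext => x; rewrite -(croot_val_sqr cM lam_full cc)//.
by have /(congr1 (fun f => f x)) /= -> := qE.
Qed.

Let derive_cst x (t : R) : t \in `[0, 1] ->
  derive_on `[0, 1] (curve_dens lam (fun=> mu) x) t = 0.
Proof.
by apply: (@derive_on_formula _ 0 1 _ (fun=> RNd mu lam x) (fun=> 0)).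
Qed.

Let velocity_cst (t : R) : t \in `[0, 1] ->
  velocity lam 0 1 (fun=> mu) t =m wmeas lam (fun=> 0).
Proof.
by move=> tl A mA; rewrite /velocity; apply: eq_integral => x _; rewrite derive_cst.
Qed.

(** Joins a measure to itself, the case in which no great circle is available. *)
Lemma constant_is_curve : is_curve lam 0 1 (fun=> mu).
Proof.
split => //.
- by move=> x; apply: (@C2_on_formula _ 0 1 _ (fun=> RNd mu lam x) (fun=> 0) (fun=> 0)) => //; exact: contC.
- move=> t tl; exists (fun=> 0); split; first exact: contC.
    by rewrite /wmeas integral0.
  exact: velocity_cst.
Qed.

Lemma constant_curve_length : curve_length lam 0 1 (fun=> mu) = 0%E.
Proof.
have /PplusP[f mf] := Pmu.
have c0 : continuous (fun _ : M => 0 : R) by exact: contC.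
rewrite /curve_length integral0_eq// => t tl.
rewrite /fisher_norm (fisher_eq cM lam_full mf c0 (velocity_cst tl) c0 (velocity_cst tl)).
rewrite (_ : \int[lam]_x _ = 0) ?sqrtr0//.
by rewrite -[RHS](Rint_cst lam 0); apply: eq_Rintegral => x _; rewrite !mul0r.
Qed.

End uniqueness.

Theorem theorem2p16 (R : realType) (n : nat) (M : ptopologicalType)
    (X : smooth_manifold R n M) (w : volume_form X)
    (lam : probability (borel M) R)
    (M_compact : compact [set: M]) (M_connected : connected [set: M])
    (lamE : is_volume_measure w lam)
    (mu mu1 : probability (borel M) R)
    (mu_Pplus : Pplus lam mu) (mu1_Pplus : Pplus lam mu1) :
  fisher_dist lam mu mu1 = (ell mu mu1)%:E /\
  (~ (mu =m mu1) ->
   let l := ell mu mu1 in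
   let tau := init_velocity mu mu1 in
   exists c : R -> probability (borel M) R,
     [/\ (forall t, t \in `[0, l] ->
            c t =m wmeas mu (fun x =>
              (cos (t / 2) + sin (t / 2) * RNd tau mu x) ^+ 2)),
         shortest_path lam 0 [:: l] c mu mu1,
         unit_geodesic_segment lam l c mu mu1 &
         (forall c' : R -> probability (borel M) R,
            unit_geodesic_segment lam l c' mu mu1 ->
            forall t, t \in `[0, l] -> c' t =m c t)]).
Proof.
have full := volume_full_support lamE.
have lower := ell_le_fisher_dist M_compact full mu_Pplus mu1_Pplus.
have [mu_eq|mu_neq] := pselect (mu =m mu1).
  split => //; apply/eqP; rewrite eq_le lower andbT.
  have -> : ell mu mu1 = 0.
    rewrite (ellE M_compact full mu_Pplus mu1_Pplus).
    rewrite -(eqm_root_density M_compact full mu_Pplus mu_eq).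
    have [_ i1] := unit_root_density M_compact full mu_Pplus.
    by rewrite /angle i1 acos1 mulr0.
  apply: ereal_inf_lbound; exists 0, [:: 1], (fun=> mu); split.
    by split => //=; split => //; exact: constant_is_curve.
  by rewrite /= (constant_curve_length M_compact full mu_Pplus) adde0.
have [c cP] := exists_circle_curve M_compact full mu_Pplus mu1_Pplus mu_neq.
have lenE : pw_length lam 0 [:: ell mu mu1] c = (ell mu mu1)%:E.
  by rewrite /= adde0 (circle_length M_compact full mu_Pplus mu1_Pplus mu_neq cP).
have join := circle_joins M_compact full mu_Pplus mu1_Pplus mu_neq cP.
have distE : fisher_dist lam mu mu1 = (ell mu mu1)%:E.
  apply/eqP; rewrite eq_le lower andbT -lenE.
  by apply: ereal_inf_lbound; exists 0, [:: ell mu mu1], c.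
split => // _ /=; exists c; split.
- exact: (circle_formula M_compact full mu_Pplus mu1_Pplus mu_neq cP).
- by split => //; rewrite lenE distE.
- exact: (circle_unit_geodesic M_compact full mu_Pplus mu1_Pplus mu_neq cP).
- move=> c' geo' t tl A mA.
  have [_ _ ->//] := unit_geodesic_circle M_compact full mu_Pplus mu1_Pplus mu_neq geo' tl.
  by have [_ _ ->//] := cP t tl.
Qed.
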